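(* Let $L>0$, let $\gamma\colon\mathbb{R}/L\mathbb{Z}\to\mathbb{R}^3$ be a smooth closed arc-length parametrized curve with unit tangent $T=\gamma'$, and let $\varrho\colon\mathbb{R}/L\mathbb{Z}\to\mathbb{R}_{>0}$ be smooth. Fix $c_1>0$, $c_2\in\mathbb{R}$ and $a_0\in(0,1)$. For $0<a_1<1$ regard $\gamma$ as a vortex filament with variable thickness $a=a_1^{\varrho}$, moving with the velocity $$\dot\gamma_{a_1}=u_{\rm BS}^{(a_0)}-\log\big(\tfrac{a}{a_0}\big)\,T\times\tfrac{dT}{ds}-\tfrac{c_2}{a}\tfrac{da}{ds}\,T,\qquad u_{\rm BS}^{(a_0)}(s)=\int_0^L\frac{T(\tilde s)\times(\gamma(s)-\gamma(\tilde s))}{\big(|\gamma(s)-\gamma(\tilde s)|^2+c_1a_0^2\big)^{3/2}}\,d\tilde s.$$ Then $\gamma$ is holonomy constrained elastic with bending stiffness $\varrho$ if and only if, as the thickness tends to $0$ (i.e. $a_1\to0$), its evolution in the rescaled time $\tau=\log(a_1)\,t$ asymptotically approaches, modulo reparametrization, an infinitesimal Euclidean motion; that is, if and only if there exist $\mathbf a,\mathbf b\in\mathbb{R}^3$ such that the component normal to $T$ of $$\frac{1}{\log a_1}\,\dot\gamma_{a_1}$$ converges (uniformly on $\mathbb{R}/L\mathbb{Z}$) as $a_1\to0$ to the component normal to $T$ of the vector field $s\mapsto\mathbf a\times\gamma(s)+\mathbf b$ along $\gamma$.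
   Context: For a curve $\gamma$ and a function $g$ along it, $\frac{dg}{ds}:=g'/|\gamma'|$, $ds=|\gamma'|\,dx$, $T:=\frac{d\gamma}{ds}$. The bending energy with bending stiffness $\varrho>0$ is $\mathcal B_\varrho(\gamma):=\frac12\int\varrho\,\langle\frac{dT}{ds},\frac{dT}{ds}\rangle\,ds$ ($\varrho$ is not varied). Holonomy of $\gamma\colon[0,L]\to\mathbb{R}^3$: a normal field $Z$ along $\gamma$ ($\langle Z,T\rangle=0$) is parallel if $Z'=\lambda T$ for some smooth function $\lambda$; every normal vector at $\gamma(0)$ extends uniquely to a parallel normal field, whose value at $L$ is its parallel transport. For unit vectors $W_a\in T(0)^\perp$, $W_b\in T(L)^\perp$ and $W=(W_a,W_b)$, the holonomy $\mathcal T_W\in\mathbb{R}/2\pi\mathbb{Z}$ is the unique angle with $Z_b=\cos(\mathcal T_W)W_b+\sin(\mathcal T_W)\,T(L)\times W_b$, where $Z_b$ is the parallel transport of $W_a$. For a smooth variation $\gamma_t$ of $\gamma$ with variational vector field $\mathring\gamma=\frac{d}{dt}|_{t=0}\gamma_t$ and a functional $\mathcal F$, put $d\mathcal F(\mathring\gamma):=\frac{d}{dt}|_{t=0}\mathcal F(\gamma_t)$. An arc-length parametrized curve $\gamma$ on $[0,L]$ with bending stiffness $\varrho$ is holonomy constrained elastic if $d\mathcal B_\varrho(\mathring\gamma)=0$ for all smooth $\mathring\gamma\colon[0,L]\to\mathbb{R}^3$ with compact support in the interior of $[0,L]$ satisfying pointwise $\langle\mathring\gamma',\gamma'\rangle=0$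 (arc-length constraint) and $d\mathcal T_W(\mathring\gamma)=0$ (holonomy constraint; independent of $W$). A closed curve $\gamma\colon\mathbb{R}/L\mathbb{Z}\to\mathbb{R}^3$ is regarded as a curve on $[0,L]$. An infinitesimal Euclidean motion of $\mathbb{R}^3$ is a vector field $x\mapsto\mathbf a\times x+\mathbf b$ with $\mathbf a,\mathbf b\in\mathbb{R}^3$. The component of a velocity field tangential to $T$ only reparametrizes the curve, so ''modulo reparametrization'' means comparing normal components only. *)

(* Defs.v *)
From Stdlib Require Import Reals.
From Coquelicot Require Import Coquelicot.
Local Open Scope R_scope.

(* Euclidean 3-space, with the vector operations [plus], [minus], [scal] and
   the uniform structure that Coquelicot puts on products. *)
Definition E3 : NormedModule R_AbsRing :=
  prod_NormedModule R_AbsRing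
    (prod_NormedModule R_AbsRing R_NormedModule R_NormedModule) R_NormedModule.

Definition vec (x y z : R) : E3 := ((x, y), z).
Definition px (u : E3) : R := fst (fst u).
Definition py (u : E3) : R := snd (fst u).
Definition pz (u : E3) : R := snd u.

Definition dot (u v : E3) : R := px u * px v + py u * py v + pz u * pz v.

Definition enorm (u : E3) : R := sqrt (dot u u).

Definition cross (u v : E3) : E3 :=
  vec (py u * pz v - pz u * py v)
      (pz u * px v - px u * pz v)
      (px u * py v - py u * px v).

Definition vderive (f : R -> E3) (s : R) : E3 :=
  vec (Derive (fun x => px (f x)) s)
      (Derive (fun x => py (f x)) s)
      (Derive (fun x => pz (f x)) s).

Definition vRInt (f : R -> E3) (a b : R) : E3 :=
  vec (RInt (fun x => px (f x)) a b)
      (RInt (fun x => py (f x)) a b)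
      (RInt (fun x => pz (f x)) a b).

Definition smooth (f : R -> R) : Prop := forall n x, ex_derive_n f n x.

Definition vsmooth (f : R -> E3) : Prop :=
  smooth (fun x => px (f x)) /\
  smooth (fun x => py (f x)) /\
  smooth (fun x => pz (f x)).

(* Joint smoothness on the open strip |t| < eps. *)
Definition smooth_strip (eps : R) (f : R -> R -> R) : Prop :=
  forall n t s, Rabs t < eps -> ex_diff_n f n t s.

(* Functions on R/LZ are represented by L-periodic functions on R. *)
Definition periodic {A : Type} (L : R) (f : R -> A) : Prop :=
  forall s, f (s + L) = f s.

Definition speed (g : R -> E3) (x : R) : R := enorm (vderive g x).

(* The arc-length derivative df/ds, for f vector-valued or scalar, along g. *)
Definition vdds (g : R -> E3) (f : R -> E3) (x : R) : E3 :=
  scal (/ speed g x) (vderive f x).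

Definition dds (g : R -> E3) (f : R -> R) (x : R) : R :=
  Derive f x / speed g x.

Definition tangent (g : R -> E3) : R -> E3 := vdds g g.

Definition bending_energy (rho : R -> R) (L : R) (g : R -> E3) : R :=
  / 2 * RInt (fun x => rho x *
                dot (vdds g (tangent g) x) (vdds g (tangent g) x) *
                speed g x) 0 L.

(* Smooth functions on [0, L] are represented by smooth functions on R, the
   conditions being imposed on [0, L] only. *)
Definition parallel_normal_field (L : R) (g : R -> E3) (Z : R -> E3) : Prop :=
  vsmooth Z /\
  (forall s, 0 <= s <= L -> dot (Z s) (tangent g s) = 0) /\
  exists lambda : R -> R, smooth lambda /\
    forall s, 0 <= s <= L -> vderive Z s = scal (lambda s) (tangent g s).

(* [theta] is a real representative of the holonomy of [g] on [0, L], which is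
   an element of R/2piZ. *)
Definition holonomy_angle (L : R) (Wa Wb : E3) (g : R -> E3) (theta : R) : Prop :=
  exists Z : R -> E3,
    parallel_normal_field L g Z /\
    Z 0 = Wa /\
    Z L = plus (scal (cos theta) Wb)
               (scal (sin theta) (cross (tangent g L) Wb)).

(* Smooth variations of [g] with variational field [v], fixed near the end
   points of [0, L], so that the end tangents (and hence the frame W of the
   holonomy) do not move. *)
Definition variation (L : R) (g v : R -> E3) (G : R -> R -> E3) : Prop :=
  exists eps, 0 < eps /\
    smooth_strip eps (fun t s => px (G t s)) /\
    smooth_strip eps (fun t s => py (G t s)) /\
    smooth_strip eps (fun t s => pz (G t s)) /\
    (forall s, G 0 s = g s) /\
    (forall s, is_derive (fun t => G t s) 0 (v s)) /\
    exists alpha beta, 0 < alpha /\ alpha < beta /\ beta < L /\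
      forall t s, Rabs t < eps -> s <= alpha \/ beta <= s -> G t s = g s.

Definition first_variation (F : (R -> E3) -> R) (L : R) (g v : R -> E3)
    (d : R) : Prop :=
  forall G, variation L g v G -> is_derive (fun t => F (G t)) 0 d.

(* The derivative of an R/2piZ-valued function is that of a real lift that is
   differentiable at the point considered; it does not depend on the lift. *)
Definition holonomy_first_variation (L : R) (Wa Wb : E3) (g v : R -> E3)
    (d : R) : Prop :=
  forall G, variation L g v G ->
    exists theta : R -> R,
      locally 0 (fun t => holonomy_angle L Wa Wb (G t) (theta t)) /\
      is_derive theta 0 d.

Definition unit_normal (g : R -> E3) (s : R) (w : E3) : Prop :=
  enorm w = 1 /\ dot w (tangent g s) = 0.

Definition supported_inside (L : R) (v : R -> E3) : Prop :=
  exists alpha beta, 0 < alpha /\ alpha < beta /\ beta < L /\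
    forall s, s < alpha \/ beta < s -> v s = zero.

Definition holonomy_constrained_elastic (rho : R -> R) (L : R) (g : R -> E3)
    : Prop :=
  forall v : R -> E3,
    vsmooth v ->
    supported_inside L v ->
    (forall s, 0 <= s <= L -> dot (vderive v s) (vderive g s) = 0) ->
    (forall Wa Wb, unit_normal g 0 Wa -> unit_normal g L Wb ->
       holonomy_first_variation L Wa Wb g v 0) ->
    first_variation (bending_energy rho L) L g v 0.

Definition biot_savart (L c1 a0 : R) (g : R -> E3) (s : R) : E3 :=
  vRInt (fun s' =>
    scal (/ Rpower (Rsqr (enorm (minus (g s) (g s'))) + c1 * a0 ^ 2) (3 / 2))
         (cross (tangent g s') (minus (g s) (g s')))) 0 L.

Definition filament_velocity (L c1 c2 a0 : R) (g : R -> E3) (a : R -> R)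
    (s : R) : E3 :=
  minus
    (minus (biot_savart L c1 a0 g s)
       (scal (ln (a s / a0)) (cross (tangent g s) (vdds g (tangent g) s))))
    (scal (c2 / a s * dds g a s) (tangent g s)).

Definition normal_part (g : R -> E3) (X : R -> E3) (s : R) : E3 :=
  minus (X s) (scal (dot (X s) (tangent g s)) (tangent g s)).

Definition euclidean_motion_field (a b : E3) (x : E3) : E3 :=
  plus (cross a x) b.

(* Neighbourhoods in [fct_UniformSpace] are those of uniform convergence. *)
Definition uniform_limit_at_0 (X : R -> R -> E3) (Y : R -> E3) : Prop :=
  filterlim (X : R -> fct_UniformSpace R E3) (at_right 0)
    (locally (Y : fct_UniformSpace R E3)).

(* Main.v *)
(** Put [T = gamma'].  Divided by [ln a1], the normal velocity is
    [- rho T x T'] up to [O(1 / ln a1)], because the Biot-Savart term does not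
    depend on [a1] and is bounded; so convergence to a Euclidean motion means that
    [- rho T x T'] is the normal part of [a x gamma + b].

    This is the Euler-Lagrange equation.  For [w = v'] orthogonal to [T], the
    energy varies by [- int <(rho T')', w>] and the holonomy by
    [- int <T x T', w>], while [v] has compact support iff [w] does and
    [int w = 0].  Lagrange multipliers give
    [T x (rho T')' = T x b - c T'], which integrates to
    [- rho T x T' = b x gamma + c T - d]; conversely the tangential component of
    [a x gamma + b] is constant along a solution, and differentiating recovers the
    multipliers.

    The holonomy is computed in an explicit normal frame: by a pigeonhole argument
    some direction [e] is never parallel to [T], so [X x e], with [X] the velocity
    of the curve, is a nowhere vanishing normal field on all nearby curves, and
    parallel transport rotates against the normalized frame at an explicit rate. *)

(* Why a fixed direction [e]: by the hairy ball theorem no continuous unit normal can be prescribed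
   as a function of the tangent on the whole sphere, and the area form of the sphere, whose integral
   the holonomy varies by, has a primitive only after some directions are removed. A closed smooth
   curve has a tangent image too small to meet every direction up to sign, which leaves room for
   [e]; counting takes the place of a measure zero argument. Why an explicit frame: the angle of a
   parallel field becomes the integral of an elementary expression in the first two derivatives of
   the curve. Parallel transport and its dependence on [t] then reduce to differentiation under an
   integral, with no differential equation to solve. The holonomy constraint is a hypothesis inside
   the definition of elasticity, so its derivative is needed in two ways: a lift with the computed
   derivative must be produced in one direction, and in the other an arbitrary lift must be shown to
   have that derivative. Both first variations depend on a variation only through [v], so
   straight-line variations can serve as tests. *)
Require Import Defs.
From Stdlib Require Import Reals Lra Lia Factorial List ZArith.
From Stdlib Require Import FunctionalExtensionality Classical IndefiniteDescription.
From Coquelicot Require Import Coquelicot.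
Local Open Scope R_scope.

(** * Smooth functions of one variable *)

(** Differentiability to order [n], with no continuity asked of the last derivative. Recursing on
    [Derive f] lets closure properties be proved by induction for all functions at once, which
    iterated derivatives of products or inverses do not allow. *)
Fixpoint class_C (n : nat) (f : R -> R) : Prop :=
  match n with
  | O => True
  | S n => (forall x, ex_derive f x) /\ class_C n (Derive f)
  end.

Lemma Derive_n_Derive (f : R -> R) (n : nat) : Derive_n (Derive f) n = Derive_n f (S n).
Proof.
  apply functional_extensionality; intro x.
  change (Derive f) with (Derive_n f 1). rewrite Derive_n_comp. f_equal. lia.
Qed.

Lemma smooth_Derive (f : R -> R) : smooth f -> smooth (Derive f).
Proof.
  intros H [|n] x; [exact I|].
  simpl. rewrite Derive_n_Derive. exact (H (S (S n)) x).
Qed.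

Lemma smooth_ex_derive (f : R -> R) : smooth f -> forall x, ex_derive f x.
Proof. intros H x. exact (H 1%nat x). Qed.

Lemma smooth_is_derive (f : R -> R) : smooth f -> forall x, is_derive f x (Derive f x).
Proof. intros H x. apply Derive_correct, smooth_ex_derive, H. Qed.

Lemma smooth_continuous (f : R -> R) : smooth f -> forall x, continuous f x.
Proof. intros H x. apply @ex_derive_continuous, smooth_ex_derive, H. Qed.

Lemma class_C_ex_derive_n (n : nat) (f : R -> R) :
  class_C (S n) f -> forall x, ex_derive_n f (S n) x.
Proof.
  revert f; induction n as [|n IH]; intros f [H1 H2] x.
  - exact (H1 x).
  - specialize (IH _ H2 x). simpl in IH |- *.
    rewrite Derive_n_Derive in IH. exact IH.
Qed.

Lemma smooth_class_C (f : R -> R) : smooth f <-> forall n, class_C n f.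
Proof.
  split.
  - intros H n. revert f H. induction n as [|n IH]; intros f H; [exact I|].
    split; [apply smooth_ex_derive, H | apply IH, smooth_Derive, H].
  - intros H [|n] x; [exact I|]. apply class_C_ex_derive_n, H.
Qed.

Lemma class_C_S (n : nat) (f df : R -> R) :
  (forall x, is_derive f x (df x)) -> class_C n df -> class_C (S n) f.
Proof.
  intros H Hd. split.
  - intro x. exists (df x). apply H.
  - replace (Derive f) with df; [exact Hd|].
    apply functional_extensionality; intro x. symmetry. apply is_derive_unique, H.
Qed.

Lemma class_C_pred (n : nat) (f : R -> R) : class_C (S n) f -> class_C n f.
Proof.
  revert f; induction n as [|n IH]; intros f H; [exact I|].
  destruct H as [H1 H2]. split; [exact H1|]. apply IH, H2.
Qed.

Lemma smooth_by_derive (f df : R -> R) :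
  (forall x, is_derive f x (df x)) -> smooth df -> smooth f.
Proof.
  intros H Hd. apply smooth_class_C. intro n. apply class_C_pred.
  apply class_C_S with df; [exact H|]. apply smooth_class_C, Hd.
Qed.

Lemma class_C_const (c : R) (n : nat) : class_C n (fun _ => c).
Proof.
  revert c; induction n as [|n IH]; intro c; [exact I|].
  apply class_C_S with (fun _ => 0); [|apply IH].
  intro x. apply (is_derive_const c x).
Qed.

Lemma class_C_plus (n : nat) (f g : R -> R) :
  class_C n f -> class_C n g -> class_C n (fun x => f x + g x).
Proof.
  revert f g; induction n as [|n IH]; intros f g Hf Hg; [exact I|].
  destruct Hf as [Hf1 Hf2], Hg as [Hg1 Hg2].
  apply class_C_S with (fun x => Derive f x + Derive g x).
  - intro x. apply (is_derive_plus f g); apply Derive_correct; auto.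
  - now apply IH.
Qed.

Lemma is_derive_Rmult (f g : R -> R) (x df dg : R) :
  is_derive f x df -> is_derive g x dg ->
  is_derive (fun y => f y * g y) x (df * g x + f x * dg).
Proof.
  intros Hf Hg. apply (is_derive_mult f g x df dg Hf Hg). apply Rmult_comm.
Qed.

Lemma class_C_mult (n : nat) (f g : R -> R) :
  class_C n f -> class_C n g -> class_C n (fun x => f x * g x).
Proof.
  revert f g; induction n as [|n IH]; intros f g Hf Hg; [exact I|].
  pose proof (class_C_pred _ _ Hf). pose proof (class_C_pred _ _ Hg).
  destruct Hf as [Hf1 Hf2], Hg as [Hg1 Hg2].
  apply class_C_S with (fun x => Derive f x * g x + f x * Derive g x).
  - intro x. apply is_derive_Rmult; apply Derive_correct; auto.
  - apply class_C_plus; apply IH; auto.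
Qed.

(** The derivative of [/ f] is a polynomial in [Derive f] and [/ f] itself, so the claim one order
    lower feeds the induction. The square root works in the same way. *)
Lemma class_C_inv (n : nat) (f : R -> R) :
  (forall x, f x <> 0) -> class_C n f -> class_C n (fun x => / f x).
Proof.
  intro H0. induction n as [|n IH]; intro Hf; [exact I|].
  pose proof (IH (class_C_pred _ _ Hf)) as Hi.
  destruct Hf as [Hf1 Hf2].
  apply class_C_S with (fun x => (-1 * Derive f x) * (/ f x * / f x)).
  - intro x.
    replace (-1 * Derive f x * (/ f x * / f x)) with (- Derive f x / f x ^ 2)
      by (field; apply H0).
    apply is_derive_inv; [apply Derive_correct, Hf1 | apply H0].
  - apply class_C_mult; apply class_C_mult; auto using class_C_const.
Qed.

Lemma class_C_sqrt (n : nat) (f : R -> R) :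
  (forall x, 0 < f x) -> class_C n f -> class_C n (fun x => sqrt (f x)).
Proof.
  intro H0. induction n as [|n IH]; intro Hf; [exact I|].
  pose proof (IH (class_C_pred _ _ Hf)) as Hi.
  destruct Hf as [Hf1 Hf2].
  apply class_C_S with (fun x => Derive f x * (/ 2 * / sqrt (f x))).
  - intro x. pose proof (sqrt_lt_R0 _ (H0 x)).
    replace (Derive f x * (/ 2 * / sqrt (f x))) with (Derive f x / (2 * sqrt (f x)))
      by (field; lra).
    apply is_derive_sqrt; [apply Derive_correct, Hf1 | apply H0].
  - apply class_C_mult; [exact Hf2|]. apply class_C_mult; [apply class_C_const|].
    apply class_C_inv; [|exact Hi]. intro x. pose proof (sqrt_lt_R0 _ (H0 x)). lra.
Qed.

Lemma class_C_cos_sin (n : nat) (f : R -> R) :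
  class_C n f -> class_C n (fun x => cos (f x)) /\ class_C n (fun x => sin (f x)).
Proof.
  induction n as [|n IH]; intro Hf; [split; exact I|].
  destruct (IH (class_C_pred _ _ Hf)) as [Hc Hs].
  destruct Hf as [Hf1 Hf2].
  split.
  - apply class_C_S with (fun x => Derive f x * (-1 * sin (f x))).
    + intro x. replace (Derive f x * (-1 * sin (f x))) with (Derive f x * - sin (f x)) by ring.
      apply (is_derive_comp cos f); [apply is_derive_cos | apply Derive_correct, Hf1].
    + apply class_C_mult; [exact Hf2|]. apply class_C_mult; auto using class_C_const.
  - apply class_C_S with (fun x => Derive f x * cos (f x)).
    + intro x.
      apply (is_derive_comp sin f); [apply is_derive_sin | apply Derive_correct, Hf1].
    + apply class_C_mult; auto.
Qed.

Lemma smooth_const (c : R) : smooth (fun _ => c).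
Proof. apply smooth_class_C. intro n. apply class_C_const. Qed.

Lemma smooth_plus (f g : R -> R) : smooth f -> smooth g -> smooth (fun x => f x + g x).
Proof. rewrite !smooth_class_C. intros Hf Hg n. now apply class_C_plus. Qed.

Lemma smooth_mult (f g : R -> R) : smooth f -> smooth g -> smooth (fun x => f x * g x).
Proof. rewrite !smooth_class_C. intros Hf Hg n. now apply class_C_mult. Qed.

Lemma smooth_opp (f : R -> R) : smooth f -> smooth (fun x => - f x).
Proof.
  intro Hf. replace (fun x => - f x) with (fun x => -1 * f x)
    by (apply functional_extensionality; intro; ring).
  apply smooth_mult; auto using smooth_const.
Qed.

Lemma smooth_minus (f g : R -> R) : smooth f -> smooth g -> smooth (fun x => f x - g x).
Proof. intros. apply smooth_plus; auto using smooth_opp. Qed.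

Lemma smooth_inv (f : R -> R) :
  (forall x, f x <> 0) -> smooth f -> smooth (fun x => / f x).
Proof. rewrite !smooth_class_C. intros H0 Hf n. now apply class_C_inv. Qed.

Lemma smooth_sqrt (f : R -> R) :
  (forall x, 0 < f x) -> smooth f -> smooth (fun x => sqrt (f x)).
Proof. rewrite !smooth_class_C. intros H0 Hf n. now apply class_C_sqrt. Qed.

Lemma smooth_cos (f : R -> R) : smooth f -> smooth (fun x => cos (f x)).
Proof. rewrite !smooth_class_C. intros Hf n. now apply class_C_cos_sin. Qed.

Lemma smooth_sin (f : R -> R) : smooth f -> smooth (fun x => sin (f x)).
Proof. rewrite !smooth_class_C. intros Hf n. now apply class_C_cos_sin. Qed.

(** * Integrals and antiderivatives *)

Lemma continuous_ex_RInt (f : R -> R) (a b : R) :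
  (forall x, continuous f x) -> ex_RInt f a b.
Proof. intro H. apply (@ex_RInt_continuous R_CompleteNormedModule). auto. Qed.

Lemma smooth_ex_RInt (f : R -> R) (a b : R) : smooth f -> ex_RInt f a b.
Proof. intro H. apply continuous_ex_RInt, smooth_continuous, H. Qed.

Lemma RInt_Rmult_l (f : R -> R) (a b c : R) :
  ex_RInt f a b -> c * RInt f a b = RInt (fun x => c * f x) a b.
Proof. intro H. symmetry. exact (RInt_scal f a b c H). Qed.

Lemma RInt_Rplus (f g : R -> R) (a b : R) :
  ex_RInt f a b -> ex_RInt g a b ->
  RInt f a b + RInt g a b = RInt (fun x => f x + g x) a b.
Proof. intros Hf Hg. symmetry. exact (RInt_plus f g a b Hf Hg). Qed.

Lemma is_derive_antiderivative (f : R -> R) (a x : R) :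
  (forall x, continuous f x) -> is_derive (fun x => RInt f a x) x (f x).
Proof.
  intro H. apply is_derive_RInt with a; [|apply H].
  apply filter_forall. intro b. apply (@RInt_correct R_CompleteNormedModule).
  apply continuous_ex_RInt, H.
Qed.

Lemma smooth_antiderivative (f : R -> R) (a : R) :
  smooth f -> smooth (fun x => RInt f a x).
Proof.
  intro H. apply smooth_by_derive with f; [|exact H].
  intro x. apply is_derive_antiderivative, smooth_continuous, H.
Qed.

Lemma RInt_of_derive (F f : R -> R) (a b : R) :
  (forall x, is_derive F x (f x)) -> (forall x, continuous f x) ->
  RInt f a b = F b - F a.
Proof.
  intros HF Hf. apply is_RInt_unique. apply (is_RInt_derive F f a b); auto.
Qed.

(* The family is closed under differentiation up to linear combinations, hence
   consists of smooth functions. *)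
Definition flat (n : nat) (x : R) : R :=
  if Rlt_dec 0 x then (/ x) ^ n * exp (- / x) else 0.

(** A single term of the exponential series. The difference of the two sides at order [S n] has as
    derivative [S n] times the difference at order [n], and is positive at 0. *)
Lemma pow_le_fact_exp (n : nat) (y : R) : 0 <= y -> y ^ n <= INR (fact n) * exp y.
Proof.
  revert y. induction n as [|n IH]; intros y Hy.
  - simpl. pose proof (exp_ineq1_le y). lra.
  - set (h := fun x => INR (fact (S n)) * exp x - x ^ S n).
    set (dh := fun x => INR (fact (S n)) * exp x - INR (S n) * x ^ n).
    assert (Hd : forall x, is_derive h x (dh x)).
    { intro x. unfold h, dh. auto_derive; [exact I|].
      change (fact n + n * fact n)%nat with (fact (S n)).
      change (match n with 0%nat => 1 | S _ => INR n + 1 end) with (INR (S n)). ring. }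
    destruct (MVT_gen h 0 y dh) as [c [Hc E]].
    + intros x _. apply Hd.
    + intros x _. apply continuity_pt_filterlim, @ex_derive_continuous. eexists; apply Hd.
    + rewrite Rmin_left, Rmax_right in Hc by lra.
      assert (0 <= dh c).
      { unfold dh. specialize (IH c (proj1 Hc)).
        change (fact (S n)) with (S n * fact n)%nat. rewrite mult_INR.
        pose proof (pos_INR (S n)).
        assert (0 <= INR (S n) * (INR (fact n) * exp c - c ^ n)).
        { apply Rmult_le_pos; lra. }
        lra. }
      assert (0 <= dh c * (y - 0)) by (apply Rmult_le_pos; lra).
      assert (h 0 = INR (fact (S n))).
      { unfold h. rewrite exp_0. simpl pow. ring. }
      pose proof (pos_INR (fact (S n))).
      assert (0 <= h y) by lra. unfold h in *. lra.
Qed.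

Lemma flat_pos (n : nat) (x : R) : 0 < x -> 0 < flat n x.
Proof.
  intro H. unfold flat. destruct (Rlt_dec 0 x); [|lra].
  apply Rmult_lt_0_compat; [|apply exp_pos]. apply pow_lt, Rinv_0_lt_compat, H.
Qed.

Lemma flat_nonpos (n : nat) (x : R) : x <= 0 -> flat n x = 0.
Proof. intro H. unfold flat. destruct (Rlt_dec 0 x); lra. Qed.

(** The quadratic bound makes the difference quotient at 0 tend to 0. It is the previous inequality
    at order [n + 2], evaluated at [/ x]. *)
Lemma flat_bound (n : nat) (x : R) : Rabs (flat n x) <= INR (fact (S (S n))) * x ^ 2.
Proof.
  pose proof (pos_INR (fact (S (S n)))).
  destruct (Rle_lt_dec x 0) as [Hx|Hx].
  - rewrite flat_nonpos, Rabs_R0 by exact Hx.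
    apply Rmult_le_pos; [assumption | apply pow2_ge_0].
  - rewrite Rabs_pos_eq by (apply Rlt_le, flat_pos, Hx).
    unfold flat. destruct (Rlt_dec 0 x); [|lra].
    pose proof (Rinv_0_lt_compat _ Hx).
    pose proof (pow_le_fact_exp (S (S n)) (/ x) (Rlt_le _ _ H0)) as Hp.
    rewrite exp_Ropp. pose proof (exp_pos (/ x)).
    apply Rmult_le_reg_r with (exp (/ x) * / x ^ 2).
    { apply Rmult_lt_0_compat; [assumption|]. apply Rinv_0_lt_compat, pow_lt, Hx. }
    replace ((/ x) ^ n * / exp (/ x) * (exp (/ x) * / x ^ 2)) with ((/ x) ^ S (S n)).
    2:{ simpl pow. field. split; lra. }
    replace (INR (fact (S (S n))) * x ^ 2 * (exp (/ x) * / x ^ 2))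
      with (INR (fact (S (S n))) * exp (/ x)) by (field; lra).
    exact Hp.
Qed.

Lemma is_derive_flat (n : nat) (x : R) :
  is_derive (flat n) x (flat (S (S n)) x - INR n * flat (S n) x).
Proof.
  destruct (Rtotal_order x 0) as [Hx|[Hx|Hx]].
  - rewrite !flat_nonpos by lra. replace (0 - INR n * 0) with 0 by ring.
    apply is_derive_ext_loc with (fun _ => 0).
    + exists (mkposreal (- x) ltac:(lra)). intros y Hy. unfold ball in Hy; simpl in Hy.
      unfold AbsRing_ball, abs, minus, plus, opp in Hy; simpl in Hy.
      apply Rabs_def2 in Hy. rewrite flat_nonpos; lra.
    + apply (is_derive_const 0 x).
  - subst x. rewrite !flat_nonpos by lra. replace (0 - INR n * 0) with 0 by ring.
    apply is_derive_Reals. intros eps Heps.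
    pose proof (pos_INR (fact (S (S n)))) as HC. set (C := INR (fact (S (S n)))) in *.
    assert (Hd : 0 < eps / (C + 1)) by (apply Rdiv_lt_0_compat; lra).
    exists (mkposreal _ Hd). intros h Hh0 Hh. simpl in Hh.
    rewrite (flat_nonpos n 0) by lra.
    replace ((flat n (0 + h) - 0) / h - 0) with (flat n h * / h)
      by (rewrite Rplus_0_l; field; exact Hh0).
    rewrite Rabs_mult, Rabs_inv.
    pose proof (Rabs_pos_lt h Hh0) as Hp.
    apply Rle_lt_trans with (C * Rabs h ^ 2 * / Rabs h).
    + apply Rmult_le_compat_r; [apply Rlt_le, Rinv_0_lt_compat, Hp|].
      rewrite pow2_abs. apply flat_bound.
    + replace (C * Rabs h ^ 2 * / Rabs h) with (C * Rabs h) by (field; lra).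
      apply Rle_lt_trans with ((C + 1) * Rabs h); [nra|].
      replace eps with ((C + 1) * (eps / (C + 1))) by (field; lra).
      apply Rmult_lt_compat_l; lra.
  - apply is_derive_ext_loc with (fun x => (/ x) ^ n * exp (- / x)).
    + exists (mkposreal x Hx). intros y Hy. unfold ball in Hy; simpl in Hy.
      unfold AbsRing_ball, abs, minus, plus, opp in Hy; simpl in Hy.
      apply Rabs_def2 in Hy. unfold flat. destruct (Rlt_dec 0 y); [reflexivity|lra].
    + unfold flat. destruct (Rlt_dec 0 x); [|lra].
      auto_derive; [lra|]. destruct n as [|n].
      * simpl. field. lra.
      * change (Nat.pred (S n)) with n. simpl pow. field. lra.
Qed.

Lemma class_C_flat (k n : nat) : class_C k (flat n).
Proof.
  revert n; induction k as [|k IH]; intro n; [exact I|].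
  apply class_C_S with (fun x => flat (S (S n)) x + (-1 * INR n) * flat (S n) x).
  - intro x.
    replace (flat (S (S n)) x + -1 * INR n * flat (S n) x)
      with (flat (S (S n)) x - INR n * flat (S n) x) by ring.
    apply is_derive_flat.
  - apply class_C_plus; [apply IH|]. apply class_C_mult; [apply class_C_const|apply IH].
Qed.

Lemma class_C_comp_affine (k : nat) (f : R -> R) (c d : R) :
  class_C k f -> class_C k (fun x => f (c * x + d)).
Proof.
  revert f; induction k as [|k IH]; intros f Hf; [exact I|].
  destruct Hf as [H1 H2].
  apply class_C_S with (fun x => c * Derive f (c * x + d)).
  - intro x. apply (is_derive_comp f (fun x => c * x + d)).
    + apply Derive_correct, H1.
    + auto_derive; [exact I | ring].
  - apply class_C_mult; [apply class_C_const|]. apply IH, H2.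
Qed.

Lemma smooth_bump (a b : R) :
  exists chi : R -> R, smooth chi /\ (forall x, 0 <= chi x) /\
    (forall x, a < x < b -> 0 < chi x) /\ (forall x, x <= a \/ b <= x -> chi x = 0).
Proof.
  exists (fun x => flat 0 (1 * x + - a) * flat 0 (-1 * x + b)).
  assert (P : forall x, 0 <= flat 0 x).
  { intro x. destruct (Rle_lt_dec x 0) as [H|H].
    - rewrite flat_nonpos; lra.
    - apply Rlt_le, flat_pos, H. }
  repeat split.
  - apply smooth_class_C. intro n.
    apply class_C_mult; apply class_C_comp_affine, class_C_flat.
  - intro x. apply Rmult_le_pos; apply P.
  - intros x Hx. apply Rmult_lt_0_compat; apply flat_pos; lra.
  - intros x [Hx|Hx].
    + rewrite (flat_nonpos 0 (1 * x + - a)) by lra. ring.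
    + rewrite (flat_nonpos 0 (-1 * x + b)) by lra. ring.
Qed.

(** * Vector calculus *)

Lemma E3_eq (u v : E3) : px u = px v -> py u = py v -> pz u = pz v -> u = v.
Proof. destruct u as [[? ?] ?], v as [[? ?] ?]; unfold px, py, pz; simpl; congruence. Qed.

Ltac vsimpl :=
  unfold dot, cross, vec, minus, plus, opp, scal, zero, px, py, pz in *;
  cbn -[Rplus Rmult Rminus Ropp Rinv Rdiv] in *;
  change (@mult R_AbsRing) with Rmult in *.

Ltac vring :=
  intros;
  repeat match goal with u : E3 |- _ => destruct u as [[? ?] ?] end;
  try apply E3_eq; vsimpl; ring.

Lemma dot_comm (u v : E3) : dot u v = dot v u.
Proof. vring. Qed.
Lemma dot_plus_l (u v w : E3) : dot (plus u v) w = dot u w + dot v w.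
Proof. vring. Qed.
Lemma dot_minus_l (u v w : E3) : dot (minus u v) w = dot u w - dot v w.
Proof. vring. Qed.
Lemma dot_scal_l (c : R) (u w : E3) : dot (scal c u) w = c * dot u w.
Proof. vring. Qed.
Lemma dot_plus_r (u v w : E3) : dot w (plus u v) = dot w u + dot w v.
Proof. vring. Qed.
Lemma dot_scal_r (c : R) (u w : E3) : dot w (scal c u) = c * dot w u.
Proof. vring. Qed.
Lemma dot_zero_l (u : E3) : dot zero u = 0.
Proof. vring. Qed.
Lemma dot_cross_same_l (u v : E3) : dot (cross u v) u = 0.
Proof. vring. Qed.
Lemma dot_cross_same_r (u v : E3) : dot (cross u v) v = 0.
Proof. vring. Qed.
Lemma dot_cross_cross (a b c d : E3) :
  dot (cross a b) (cross c d) = dot a c * dot b d - dot a d * dot b c.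
Proof. vring. Qed.
Lemma triple_cross (a b c : E3) :
  cross a (cross b c) = minus (scal (dot a c) b) (scal (dot a b) c).
Proof. vring. Qed.
Lemma cross_zero_l (u : E3) : cross zero u = zero.
Proof. vring. Qed.
Lemma cross_zero_r (u : E3) : cross u zero = zero.
Proof. vring. Qed.
Lemma dot_self_ge_0 (u : E3) : 0 <= dot u u.
Proof. unfold dot. nra. Qed.

Lemma dot_self_eq_0 (u : E3) : dot u u = 0 -> u = zero.
Proof.
  destruct u as [[x y] z]. intro H. vsimpl.
  assert (x = 0) by nra. assert (y = 0) by nra. assert (z = 0) by nra. subst. reflexivity.
Qed.

Lemma enorm_sqr (u : E3) : enorm u * enorm u = dot u u.
Proof. apply sqrt_sqrt, dot_self_ge_0. Qed.

Lemma enorm_eq_1 (u : E3) : enorm u = 1 <-> dot u u = 1.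
Proof.
  split; intro H.
  - rewrite <- enorm_sqr, H. ring.
  - unfold enorm. rewrite H. apply sqrt_1.
Qed.

(** Componentwise, to match [vderive]. The [is_derive] on [E3] in the definition of a variation is
    brought to this form by [is_derive_vderive]. *)
Definition is_vderive (f : R -> E3) (s : R) (l : E3) : Prop :=
  is_derive (fun x => px (f x)) s (px l) /\
  is_derive (fun x => py (f x)) s (py l) /\
  is_derive (fun x => pz (f x)) s (pz l).

Lemma is_vderive_unique (f : R -> E3) (s : R) (l : E3) :
  is_vderive f s l -> vderive f s = l.
Proof.
  intros (H1 & H2 & H3). apply E3_eq; apply is_derive_unique; assumption.
Qed.

Lemma vsmooth_is_vderive (f : R -> E3) (s : R) : vsmooth f -> is_vderive f s (vderive f s).
Proof.
  intros (H1 & H2 & H3).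
  split; [|split]; apply Derive_correct, smooth_ex_derive; assumption.
Qed.

Lemma vsmooth_vderive (f : R -> E3) : vsmooth f -> vsmooth (vderive f).
Proof.
  intros (H1 & H2 & H3).
  split; [|split]; apply smooth_Derive in H1, H2, H3; assumption.
Qed.

Lemma is_vderive_const (u : E3) (s : R) : is_vderive (fun _ => u) s zero.
Proof. split; [|split]; apply (is_derive_const (_ : R) s). Qed.

Lemma is_vderive_plus (f g : R -> E3) (s : R) (df dg : E3) :
  is_vderive f s df -> is_vderive g s dg ->
  is_vderive (fun x => plus (f x) (g x)) s (plus df dg).
Proof.
  intros (F1 & F2 & F3) (G1 & G2 & G3).
  split; [|split].
  - apply (is_derive_plus _ _ _ _ _ F1 G1).
  - apply (is_derive_plus _ _ _ _ _ F2 G2).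
  - apply (is_derive_plus _ _ _ _ _ F3 G3).
Qed.

Lemma is_vderive_minus (f g : R -> E3) (s : R) (df dg : E3) :
  is_vderive f s df -> is_vderive g s dg ->
  is_vderive (fun x => minus (f x) (g x)) s (minus df dg).
Proof.
  intros (F1 & F2 & F3) (G1 & G2 & G3).
  split; [|split].
  - apply (is_derive_minus _ _ _ _ _ F1 G1).
  - apply (is_derive_minus _ _ _ _ _ F2 G2).
  - apply (is_derive_minus _ _ _ _ _ F3 G3).
Qed.

Lemma is_vderive_scal (c : R -> R) (f : R -> E3) (s dc : R) (df : E3) :
  is_derive c s dc -> is_vderive f s df ->
  is_vderive (fun x => scal (c x) (f x)) s (plus (scal dc (f s)) (scal (c s) df)).
Proof.
  intros C (F1 & F2 & F3).
  split; [|split].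
  - apply (is_derive_Rmult _ _ _ _ _ C F1).
  - apply (is_derive_Rmult _ _ _ _ _ C F2).
  - apply (is_derive_Rmult _ _ _ _ _ C F3).
Qed.

Lemma is_derive_eq (f : R -> R) (x l l' : R) : is_derive f x l -> l = l' -> is_derive f x l'.
Proof. intros H <-. exact H. Qed.

Lemma is_vderive_eq (f : R -> E3) (s : R) (l l' : E3) :
  is_vderive f s l -> l = l' -> is_vderive f s l'.
Proof. intros H <-. exact H. Qed.

Lemma is_derive_dot (f g : R -> E3) (s : R) (df dg : E3) :
  is_vderive f s df -> is_vderive g s dg ->
  is_derive (fun x => dot (f x) (g x)) s (dot df (g s) + dot (f s) dg).
Proof.
  intros (F1 & F2 & F3) (G1 & G2 & G3). unfold dot.
  eapply is_derive_eq.
  - apply (is_derive_plus (fun x => px (f x) * px (g x) + py (f x) * py (g x))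
             (fun x => pz (f x) * pz (g x))).
    + apply (is_derive_plus (fun x => px (f x) * px (g x)) (fun x => py (f x) * py (g x)));
        apply is_derive_Rmult; eassumption.
    + apply is_derive_Rmult; eassumption.
  - unfold plus; simpl. ring.
Qed.

Lemma is_vderive_cross (f g : R -> E3) (s : R) (df dg : E3) :
  is_vderive f s df -> is_vderive g s dg ->
  is_vderive (fun x => cross (f x) (g x)) s (plus (cross df (g s)) (cross (f s) dg)).
Proof.
  intros (F1 & F2 & F3) (G1 & G2 & G3).
  split; [|split].
  - eapply is_derive_eq.
    + apply (is_derive_minus (fun x => py (f x) * pz (g x)) (fun x => pz (f x) * py (g x)));
        apply is_derive_Rmult; eassumption.
    + cbv [px py pz cross vec]. unfold minus, plus, opp. simpl. unfold plus. simpl. ring.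
  - eapply is_derive_eq.
    + apply (is_derive_minus (fun x => pz (f x) * px (g x)) (fun x => px (f x) * pz (g x)));
        apply is_derive_Rmult; eassumption.
    + cbv [px py pz cross vec]. unfold minus, plus, opp. simpl. unfold plus. simpl. ring.
  - eapply is_derive_eq.
    + apply (is_derive_minus (fun x => px (f x) * py (g x)) (fun x => py (f x) * px (g x)));
        apply is_derive_Rmult; eassumption.
    + cbv [px py pz cross vec]. unfold minus, plus, opp. simpl. unfold plus. simpl. ring.
Qed.

Lemma vsmooth_const (u : E3) : vsmooth (fun _ => u).
Proof. split; [|split]; apply smooth_const. Qed.

Lemma vsmooth_plus (f g : R -> E3) :
  vsmooth f -> vsmooth g -> vsmooth (fun x => plus (f x) (g x)).
Proof.
  intros (F1 & F2 & F3) (G1 & G2 & G3).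
  split; [|split].
  - apply (smooth_plus _ _ F1 G1).
  - apply (smooth_plus _ _ F2 G2).
  - apply (smooth_plus _ _ F3 G3).
Qed.

Lemma vsmooth_minus (f g : R -> E3) :
  vsmooth f -> vsmooth g -> vsmooth (fun x => minus (f x) (g x)).
Proof.
  intros (F1 & F2 & F3) (G1 & G2 & G3).
  split; [|split].
  - apply (smooth_minus _ _ F1 G1).
  - apply (smooth_minus _ _ F2 G2).
  - apply (smooth_minus _ _ F3 G3).
Qed.

Lemma vsmooth_scal (c : R -> R) (f : R -> E3) :
  smooth c -> vsmooth f -> vsmooth (fun x => scal (c x) (f x)).
Proof.
  intros C (F1 & F2 & F3).
  split; [|split].
  - apply (smooth_mult _ _ C F1).
  - apply (smooth_mult _ _ C F2).
  - apply (smooth_mult _ _ C F3).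
Qed.

Lemma smooth_dot (f g : R -> E3) :
  vsmooth f -> vsmooth g -> smooth (fun x => dot (f x) (g x)).
Proof.
  intros (F1 & F2 & F3) (G1 & G2 & G3). unfold dot.
  apply smooth_plus; [apply smooth_plus|]; apply smooth_mult; assumption.
Qed.

Lemma vsmooth_cross (f g : R -> E3) :
  vsmooth f -> vsmooth g -> vsmooth (fun x => cross (f x) (g x)).
Proof.
  intros (F1 & F2 & F3) (G1 & G2 & G3).
  split; [|split]; apply smooth_minus; apply smooth_mult; assumption.
Qed.

Lemma is_vderive_antiderivative (f : R -> E3) (a s : R) :
  vsmooth f -> is_vderive (fun x => vRInt f a x) s (f s).
Proof.
  intros (F1 & F2 & F3).
  split; [|split].
  - apply (is_derive_antiderivative (fun x => px (f x))). apply smooth_continuous, F1.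
  - apply (is_derive_antiderivative (fun x => py (f x))). apply smooth_continuous, F2.
  - apply (is_derive_antiderivative (fun x => pz (f x))). apply smooth_continuous, F3.
Qed.

Lemma vsmooth_antiderivative (f : R -> E3) (a : R) :
  vsmooth f -> vsmooth (fun x => vRInt f a x).
Proof.
  intros (F1 & F2 & F3).
  split; [|split].
  - apply (smooth_antiderivative _ a F1).
  - apply (smooth_antiderivative _ a F2).
  - apply (smooth_antiderivative _ a F3).
Qed.

Lemma is_vderive_ext_loc (f g : R -> E3) (s : R) (l : E3) :
  locally s (fun x => f x = g x) -> is_vderive f s l -> is_vderive g s l.
Proof.
  intros H (F1 & F2 & F3).
  split; [|split]; (eapply is_derive_ext_loc; [|eassumption]);
    revert H; apply filter_imp; intros x ->; reflexivity.
Qed.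

Lemma vderive_ext_loc (f g : R -> E3) (s : R) :
  locally s (fun x => f x = g x) -> vderive f s = vderive g s.
Proof.
  intro H. unfold vderive.
  f_equal; apply Derive_ext_loc; revert H; apply filter_imp; intros x ->; reflexivity.
Qed.

(** Orthogonality to [t] and [n] kills the product of [u] with [cross t n], and Lagrange's identity
    then gives the norm of [u]. Vector identities below are checked on the three vectors of such a
    frame. *)
Lemma orthonormal_zero (t n u : E3) :
  dot t t = 1 -> dot n n = 1 -> dot t n = 0 ->
  dot u t = 0 -> dot u n = 0 -> dot u (cross t n) = 0 -> u = zero.
Proof.
  intros Ht Hn Htn Hut Hun Hub.
  set (b := cross t n) in *.
  assert (Hb : dot b b = 1).
  { unfold b. rewrite dot_cross_cross, Ht, Hn, (dot_comm n t), Htn. ring. }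
  assert (Hc : cross u b = zero).
  { unfold b. rewrite triple_cross, Hun, Hut. vring. }
  apply dot_self_eq_0.
  pose proof (dot_cross_cross u b u b) as E.
  rewrite Hc, dot_zero_l, Hb, Hub, (dot_comm b u), Hub in E. lra.
Qed.

Lemma minus_zero_eq (u v : E3) : minus u v = zero -> u = v.
Proof.
  intro H. transitivity (plus (minus u v) v); [vring|].
  rewrite H. vring.
Qed.

(** * Functions of two variables on a strip *)

(** What differentiation under the integral sign asks of an integrand. The derivative is carried as
    an argument, so that the derivative of a composite integrand is assembled by the lemmas instead
    of being guessed. *)
Definition C1_strip (d : R) (f ft : R -> R -> R) : Prop :=
  forall t s, Rabs t < d ->
    is_derive (fun u => f u s) t (ft t s) /\
    continuity_2d_pt f t s /\ continuity_2d_pt ft t s.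

Lemma locally_strip (d t : R) : Rabs t < d -> locally t (fun u => Rabs u < d).
Proof.
  intro H. exists (mkposreal (d - Rabs t) ltac:(lra)). intros u Hu.
  unfold ball in Hu; simpl in Hu. unfold AbsRing_ball, abs, minus, plus, opp in Hu; simpl in Hu.
  replace u with (t + (u + - t)) by ring. eapply Rle_lt_trans; [apply Rabs_triang|]. lra.
Qed.

Lemma locally_2d_strip (d t s : R) (P : R -> R -> Prop) :
  Rabs t < d -> (forall u v, Rabs u < d -> P u v) -> locally_2d P t s.
Proof.
  intros H HP. exists (mkposreal (d - Rabs t) ltac:(lra)). simpl. intros u v Hu _.
  apply HP. replace u with (t + (u - t)) by ring.
  eapply Rle_lt_trans; [apply Rabs_triang|]. lra.
Qed.

Lemma continuity_2d_pt_section_r (f : R -> R -> R) (t s : R) :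
  continuity_2d_pt f t s -> continuous (f t) s.
Proof.
  intro H. apply continuity_pt_filterlim. intros eps Heps.
  destruct (H (mkposreal eps Heps)) as [d Hd].
  exists d. split; [apply cond_pos|]. intros x [_ Hx].
  apply Hd; [|exact Hx]. rewrite Rminus_diag, Rabs_R0. apply cond_pos.
Qed.

Lemma continuity_2d_pt_section_const (f : R -> R) (t s : R) :
  continuous f s -> continuity_2d_pt (fun _ v => f v) t s.
Proof.
  intro H. apply (continuity_1d_2d_pt_comp f (fun _ v => v)).
  - apply continuity_pt_filterlim, H.
  - apply continuity_2d_pt_id2.
Qed.

Lemma C1_strip_is_derive_RInt (d a b : R) (f ft : R -> R -> R) :
  0 < d -> C1_strip d f ft ->
  is_derive (fun t => RInt (f t) a b) 0 (RInt (ft 0) a b).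
Proof.
  intros Hd H. assert (H0 : Rabs 0 < d) by (rewrite Rabs_R0; exact Hd).
  assert (E : forall u v, Rabs u < d -> Derive (fun z => f z v) u = ft u v).
  { intros u v Hu. apply is_derive_unique, (H u v Hu). }
  rewrite (RInt_ext (ft 0) (fun s => Derive (fun u => f u s) 0)).
  2:{ intros s _. symmetry. apply E, H0. }
  apply is_derive_RInt_param.
  - apply filter_imp with (2 := locally_strip d 0 H0).
    intros u Hu s _. exists (ft u s). apply (H u s Hu).
  - intros s _. apply continuity_2d_pt_ext_loc with ft.
    + apply locally_2d_strip with d; [exact H0|]. intros u v Hu. symmetry. now apply E.
    + apply (H 0 s H0).
  - apply filter_imp with (2 := locally_strip d 0 H0).
    intros u Hu. apply continuous_ex_RInt. intro s.
    apply continuity_2d_pt_section_r, (H u s Hu).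
Qed.

Lemma C1_strip_ex_RInt (d a b : R) (f ft : R -> R -> R) :
  0 < d -> C1_strip d f ft -> ex_RInt (ft 0) a b.
Proof.
  intros Hd H. apply continuous_ex_RInt. intro s.
  apply continuity_2d_pt_section_r, (H 0 s). rewrite Rabs_R0. exact Hd.
Qed.

(** * Partial derivatives of jointly smooth functions *)

Definition dt (f : R -> R -> R) (t s : R) : R := Derive (fun u => f u s) t.
Definition ds (f : R -> R -> R) (t s : R) : R := Derive (fun v => f t v) s.

Lemma smooth_strip_dt (eps : R) (f : R -> R -> R) : smooth_strip eps f -> smooth_strip eps (dt f).
Proof. intros H n t s Ht. exact (proj1 (proj2 (proj2 (proj2 (H (S n) t s Ht))))). Qed.

Lemma smooth_strip_ds (eps : R) (f : R -> R -> R) : smooth_strip eps f -> smooth_strip eps (ds f).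
Proof. intros H n t s Ht. exact (proj2 (proj2 (proj2 (proj2 (H (S n) t s Ht))))). Qed.

Lemma smooth_strip_continuity (eps : R) (f : R -> R -> R) (t s : R) :
  smooth_strip eps f -> Rabs t < eps -> continuity_2d_pt f t s.
Proof. intros H Ht. exact (proj1 (H 0%nat t s Ht)). Qed.

Lemma smooth_strip_ex_dt (eps : R) (f : R -> R -> R) (t s : R) :
  smooth_strip eps f -> Rabs t < eps -> ex_derive (fun u => f u s) t.
Proof. intros H Ht. exact (proj1 (proj2 (H 1%nat t s Ht))). Qed.

Lemma smooth_strip_ex_ds (eps : R) (f : R -> R -> R) (t s : R) :
  smooth_strip eps f -> Rabs t < eps -> ex_derive (f t) s.
Proof. intros H Ht. exact (proj1 (proj2 (proj2 (H 1%nat t s Ht)))). Qed.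

Lemma smooth_strip_C1 (eps : R) (f : R -> R -> R) : smooth_strip eps f -> C1_strip eps f (dt f).
Proof.
  intros H t s Ht. split; [|split].
  - apply Derive_correct, smooth_strip_ex_dt with eps; assumption.
  - apply smooth_strip_continuity with eps; assumption.
  - apply smooth_strip_continuity with eps; [apply smooth_strip_dt|]; assumption.
Qed.

Lemma smooth_strip_section (eps : R) (f : R -> R -> R) (t : R) :
  smooth_strip eps f -> Rabs t < eps -> smooth (f t).
Proof.
  intros H Ht. apply smooth_class_C. intro n. revert f H.
  induction n as [|n IH]; intros f H; [exact I|]. split.
  - intro s. apply smooth_strip_ex_ds with eps; assumption.
  - apply (IH (ds f)), smooth_strip_ds, H.
Qed.

Lemma dt_ds_comm (eps : R) (f : R -> R -> R) (t s : R) :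
  smooth_strip eps f -> Rabs t < eps -> dt (ds f) t s = ds (dt f) t s.
Proof.
  intros H Ht. apply (Schwarz f t s).
  - apply locally_2d_strip with eps; [exact Ht|]. intros u v Hu. repeat split.
    + apply smooth_strip_ex_dt with eps; assumption.
    + apply smooth_strip_ex_ds with eps; assumption.
    + apply (smooth_strip_ex_dt eps (ds f)); [apply smooth_strip_ds|]; assumption.
    + apply (smooth_strip_ex_ds eps (dt f)); [apply smooth_strip_dt|]; assumption.
  - apply (smooth_strip_continuity eps (dt (ds f))); [|exact Ht].
    apply smooth_strip_dt, smooth_strip_ds, H.
  - apply (smooth_strip_continuity eps (ds (dt f))); [|exact Ht].
    apply smooth_strip_ds, smooth_strip_dt, H.
Qed.

Lemma dt_ds_ds_comm (eps : R) (f : R -> R -> R) (t s : R) :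
  smooth_strip eps f -> Rabs t < eps -> dt (ds (ds f)) t s = ds (ds (dt f)) t s.
Proof.
  intros H Ht. rewrite (dt_ds_comm eps) by (auto using smooth_strip_ds).
  unfold ds at 1 3. apply Derive_ext. intro v. apply dt_ds_comm with eps; assumption.
Qed.

Lemma C1_strip_shrink (d d' : R) (f ft : R -> R -> R) :
  d' <= d -> C1_strip d f ft -> C1_strip d' f ft.
Proof. intros Hd H t s Ht. apply H. lra. Qed.

(** The line is not compact, but nothing moves with [t] outside [[a, b]]. On [[a, b]] the function
    [f 0] has a positive minimum [m], and uniform continuity keeps [f t] within [m] of it. This
    gives one range of [t] on which all nearby curves stay regular and transversal to [e]. *)
Lemma strip_positive (d a b : R) (f : R -> R -> R) :
  0 < d -> (forall s, continuity_2d_pt f 0 s) -> (forall s, 0 < f 0 s) ->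
  (forall t s, Rabs t < d -> s <= a \/ b <= s -> f t s = f 0 s) ->
  exists d', 0 < d' /\ d' <= d /\ forall t s, Rabs t < d' -> 0 < f t s.
Proof.
  intros Hd Hc Hp Hout.
  destruct (Rle_lt_dec b a) as [Hab|Hab].
  { exists d. split; [|split]; [assumption|lra|]. intros t s Ht. rewrite Hout; auto. lra. }
  assert (Hm : exists m, 0 < m /\ forall s, a <= s <= b -> m <= f 0 s).
  { destruct (continuity_ab_min (f 0) a b) as [m [Hm1 Hm2]]; [lra| |].
    - intros s _. apply continuity_pt_filterlim, continuity_2d_pt_section_r, Hc.
    - exists (f 0 m). auto. }
  destruct Hm as [m [Hm0 Hm]].
  destruct (uniform_continuity_2d_1d' f a b 0 (fun s _ => Hc s) (mkposreal m Hm0))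
    as [e He].
  exists (Rmin d e). pose proof (cond_pos e).
  split; [now apply Rmin_pos|]. split; [apply Rmin_l|].
  intros t s Ht.
  pose proof (Rmin_l d e). pose proof (Rmin_r d e).
  destruct (Rle_lt_dec s a); [rewrite Hout; auto; lra|].
  destruct (Rle_lt_dec b s); [rewrite Hout; auto; lra|].
  assert (Ht' : Rabs t < e) by lra. apply Rabs_def2 in Ht'.
  specialize (He s 0 s t ltac:(lra) ltac:(lra) ltac:(lra) ltac:(lra)).
  rewrite Rminus_diag, Rabs_R0 in He. specialize (He ltac:(lra)). simpl in He.
  apply Rabs_def2 in He. specialize (Hm s ltac:(lra)). lra.
Qed.

Lemma is_derive_vderive (f : R -> E3) (s : R) (l : E3) : is_derive f s l -> is_vderive f s l.
Proof.
  intro H.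
  assert (H1 : filterdiff (fun x => fst (f x)) (locally s) (fun y => fst (scal y l))).
  { apply (filterdiff_comp' f fst s _ fst); [exact H|].
    apply filterdiff_linear, is_linear_fst. }
  assert (H2 : filterdiff (fun x => snd (f x)) (locally s) (fun y => snd (scal y l))).
  { apply (filterdiff_comp' f snd s _ snd); [exact H|].
    apply filterdiff_linear, is_linear_snd. }
  split; [|split].
  - apply (filterdiff_comp' (fun x => fst (f x)) fst s (fun y => fst (scal y l)) fst); [exact H1|].
    apply filterdiff_linear, is_linear_fst.
  - apply (filterdiff_comp' (fun x => fst (f x)) snd s (fun y => fst (scal y l)) snd); [exact H1|].
    apply filterdiff_linear, is_linear_snd.
  - exact H2.
Qed.

Definition vC1_strip (d : R) (F Ft : R -> R -> E3) : Prop :=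
  C1_strip d (fun t s => px (F t s)) (fun t s => px (Ft t s)) /\
  C1_strip d (fun t s => py (F t s)) (fun t s => py (Ft t s)) /\
  C1_strip d (fun t s => pz (F t s)) (fun t s => pz (Ft t s)).

Lemma C1_strip_plus (d : R) (f ft g gt : R -> R -> R) :
  C1_strip d f ft -> C1_strip d g gt ->
  C1_strip d (fun t s => f t s + g t s) (fun t s => ft t s + gt t s).
Proof.
  intros Hf Hg t s Ht. destruct (Hf t s Ht) as (F1 & F2 & F3), (Hg t s Ht) as (G1 & G2 & G3).
  split; [|split].
  - apply (is_derive_plus _ _ _ _ _ F1 G1).
  - now apply continuity_2d_pt_plus.
  - now apply continuity_2d_pt_plus.
Qed.

Lemma C1_strip_minus (d : R) (f ft g gt : R -> R -> R) :
  C1_strip d f ft -> C1_strip d g gt ->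
  C1_strip d (fun t s => f t s - g t s) (fun t s => ft t s - gt t s).
Proof.
  intros Hf Hg t s Ht. destruct (Hf t s Ht) as (F1 & F2 & F3), (Hg t s Ht) as (G1 & G2 & G3).
  split; [|split].
  - apply (is_derive_minus _ _ _ _ _ F1 G1).
  - now apply continuity_2d_pt_minus.
  - now apply continuity_2d_pt_minus.
Qed.

Lemma C1_strip_mult (d : R) (f ft g gt : R -> R -> R) :
  C1_strip d f ft -> C1_strip d g gt ->
  C1_strip d (fun t s => f t s * g t s) (fun t s => ft t s * g t s + f t s * gt t s).
Proof.
  intros Hf Hg t s Ht. destruct (Hf t s Ht) as (F1 & F2 & F3), (Hg t s Ht) as (G1 & G2 & G3).
  split; [|split].
  - apply (is_derive_Rmult (fun u => f u s) (fun u => g u s)); assumption.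
  - now apply continuity_2d_pt_mult.
  - apply continuity_2d_pt_plus; now apply continuity_2d_pt_mult.
Qed.

Lemma C1_strip_inv (d : R) (f ft : R -> R -> R) :
  (forall t s, Rabs t < d -> 0 < f t s) -> C1_strip d f ft ->
  C1_strip d (fun t s => / f t s) (fun t s => - ft t s * (/ f t s * / f t s)).
Proof.
  intros H0 Hf t s Ht. destruct (Hf t s Ht) as (F1 & F2 & F3). specialize (H0 t s Ht).
  assert (C : continuity_2d_pt (fun t s => / f t s) t s).
  { apply continuity_2d_pt_inv; [exact F2|lra]. }
  split; [|split].
  - eapply is_derive_eq; [apply (is_derive_inv (fun u => f u s)); [exact F1|lra]|]. field. lra.
  - exact C.
  - apply continuity_2d_pt_mult; [now apply continuity_2d_pt_opp|].
    now apply continuity_2d_pt_mult.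
Qed.

Lemma C1_strip_sqrt (d : R) (f ft : R -> R -> R) :
  (forall t s, Rabs t < d -> 0 < f t s) -> C1_strip d f ft ->
  C1_strip d (fun t s => sqrt (f t s)) (fun t s => ft t s * / (2 * sqrt (f t s))).
Proof.
  intros H0 Hf t s Ht. destruct (Hf t s Ht) as (F1 & F2 & F3). specialize (H0 t s Ht).
  pose proof (sqrt_lt_R0 _ H0).
  assert (C : continuity_2d_pt (fun t s => sqrt (f t s)) t s).
  { apply (continuity_1d_2d_pt_comp sqrt f); [|exact F2].
    apply continuity_pt_sqrt. lra. }
  split; [|split].
  - apply (is_derive_sqrt (fun u => f u s)); assumption.
  - exact C.
  - apply continuity_2d_pt_mult; [exact F3|].
    apply continuity_2d_pt_inv; [|lra].
    apply continuity_2d_pt_mult; [apply continuity_2d_pt_const|exact C].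
Qed.

Lemma C1_strip_section (d : R) (f : R -> R) :
  (forall s, continuous f s) -> C1_strip d (fun _ s => f s) (fun _ _ => 0).
Proof.
  intros Hf t s Ht. split; [|split].
  - apply (is_derive_const (f s) t).
  - apply continuity_2d_pt_section_const, Hf.
  - apply continuity_2d_pt_const.
Qed.

Lemma C1_strip_ext (d : R) (f ft ft' : R -> R -> R) :
  (forall t s, ft t s = ft' t s) -> C1_strip d f ft -> C1_strip d f ft'.
Proof.
  intros E H. replace ft' with ft; [exact H|].
  apply functional_extensionality; intro t. apply functional_extensionality; intro s. apply E.
Qed.

Lemma C1_strip_dot (d : R) (F Ft G Gt : R -> R -> E3) :
  vC1_strip d F Ft -> vC1_strip d G Gt ->
  C1_strip d (fun t s => dot (F t s) (G t s))
    (fun t s => dot (Ft t s) (G t s) + dot (F t s) (Gt t s)).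
Proof.
  intros (F1 & F2 & F3) (G1 & G2 & G3).
  eapply C1_strip_ext; [|exact (C1_strip_plus d _ _ _ _
    (C1_strip_plus d _ _ _ _ (C1_strip_mult d _ _ _ _ F1 G1) (C1_strip_mult d _ _ _ _ F2 G2))
    (C1_strip_mult d _ _ _ _ F3 G3))].
  intros t s. unfold dot. ring.
Qed.

Lemma vC1_strip_const (d : R) (e : E3) : vC1_strip d (fun _ _ => e) (fun _ _ => zero).
Proof. split; [|split]; apply C1_strip_section; intro; apply continuous_const. Qed.

Lemma vC1_strip_cross (d : R) (F Ft G Gt : R -> R -> E3) :
  vC1_strip d F Ft -> vC1_strip d G Gt ->
  vC1_strip d (fun t s => cross (F t s) (G t s))
    (fun t s => plus (cross (Ft t s) (G t s)) (cross (F t s) (Gt t s))).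
Proof.
  intros (F1 & F2 & F3) (G1 & G2 & G3).
  split; [|split]; (eapply C1_strip_ext; [|apply C1_strip_minus; apply C1_strip_mult; eassumption]);
    intros t s; cbv [px py pz cross vec]; unfold plus; simpl; unfold plus; simpl; ring.
Qed.

Lemma vC1_strip_shrink (d d' : R) (F Ft : R -> R -> E3) :
  d' <= d -> vC1_strip d F Ft -> vC1_strip d' F Ft.
Proof.
  intros Hd (H1 & H2 & H3). split; [|split]; apply C1_strip_shrink with d; assumption.
Qed.

(** * Derivatives of the curves of a variation *)

Lemma locally_lt (a s : R) : s < a -> locally s (fun x => x < a).
Proof. intro H. apply (open_lt a). exact H. Qed.

Lemma locally_gt (a s : R) : a < s -> locally s (fun x => a < x).
Proof. intro H. apply (open_gt a). exact H. Qed.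

Lemma vderive_agree (alpha beta : R) (g h : R -> E3) :
  (forall s, s < alpha \/ beta < s -> g s = h s) ->
  forall s, s < alpha \/ beta < s -> vderive g s = vderive h s.
Proof.
  intros H s [Hs|Hs]; apply vderive_ext_loc.
  - apply filter_imp with (2 := locally_lt _ _ Hs). auto.
  - apply filter_imp with (2 := locally_gt _ _ Hs). auto.
Qed.

(** All that the two first variations use of [G]: its first two derivatives in [s], whose
    [t]-derivatives at 0 are those of [v] because mixed partial derivatives commute, its rest near
    the ends, and its regularity. [G] itself enters no first variation beyond [v]. *)
Lemma variation_jets (L : R) (g v : R -> E3) (G : R -> R -> E3) :
  vsmooth g -> (forall s, speed g s = 1) -> variation L g v G ->
  exists d alpha beta (Xt Wt : R -> R -> E3),
    0 < d /\ 0 < alpha /\ alpha < beta /\ beta < L /\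
    (forall s, G 0 s = g s) /\
    (forall t, Rabs t < d -> vsmooth (G t)) /\
    vC1_strip d (fun t s => vderive (G t) s) Xt /\
    vC1_strip d (fun t s => vderive (vderive (G t)) s) Wt /\
    (forall s, Xt 0 s = vderive v s) /\
    (forall s, Wt 0 s = vderive (vderive v) s) /\
    (forall t s, Rabs t < d -> s < alpha \/ beta < s -> vderive (G t) s = vderive g s) /\
    (forall t s, Rabs t < d -> 0 < dot (vderive (G t) s) (vderive (G t) s)).
Proof.
  intros Hg Hs (eps & Heps & HX & HY & HZ & H0 & Hv & alpha & beta & Ha & Hab & Hb & Hout).
  assert (Z : Rabs 0 < eps) by (rewrite Rabs_R0; exact Heps).
  assert (E0 : G 0 = g) by (apply functional_extensionality; exact H0).
  assert (Vx : forall s, dt (fun t s => px (G t s)) 0 s = px (v s)).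
  { intro s. apply is_derive_unique, (is_derive_vderive _ _ _ (Hv s)). }
  assert (Vy : forall s, dt (fun t s => py (G t s)) 0 s = py (v s)).
  { intro s. apply is_derive_unique, (is_derive_vderive _ _ _ (Hv s)). }
  assert (Vz : forall s, dt (fun t s => pz (G t s)) 0 s = pz (v s)).
  { intro s. apply is_derive_unique, (is_derive_vderive _ _ _ (Hv s)). }
  set (Xt := fun t s => vec (dt (ds (fun t s => px (G t s))) t s)
    (dt (ds (fun t s => py (G t s))) t s) (dt (ds (fun t s => pz (G t s))) t s)).
  set (Wt := fun t s => vec (dt (ds (ds (fun t s => px (G t s)))) t s)
    (dt (ds (ds (fun t s => py (G t s)))) t s) (dt (ds (ds (fun t s => pz (G t s)))) t s)).
  assert (CX : vC1_strip eps (fun t s => vderive (G t) s) Xt).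
  { split; [|split]; apply smooth_strip_C1, smooth_strip_ds; assumption. }
  assert (CW : vC1_strip eps (fun t s => vderive (vderive (G t)) s) Wt).
  { split; [|split]; apply smooth_strip_C1, smooth_strip_ds, smooth_strip_ds; assumption. }
  assert (Hd : forall t s, Rabs t < eps -> s < alpha \/ beta < s ->
            vderive (G t) s = vderive g s).
  { intros t s Ht. apply vderive_agree. intros x Hx. apply Hout; [exact Ht|lra]. }
  assert (Hdot : C1_strip eps (fun t s => dot (vderive (G t) s) (vderive (G t) s)) _)
    by (apply C1_strip_dot; exact CX).
  (* The velocities are known to agree only strictly outside [[alpha, beta]], while [strip_positive]
     wants a closed outer region; the midpoints leave a margin. *)
  destruct (strip_positive eps (alpha / 2) ((beta + L) / 2)
              (fun t s => dot (vderive (G t) s) (vderive (G t) s)) Heps)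
    as (d & Hd0 & Hde & Hpos).
  - intro s. apply (Hdot 0 s Z).
  - intro s. rewrite E0. specialize (Hs s). apply enorm_eq_1 in Hs. rewrite Hs. lra.
  - intros t s Ht Hos. rewrite E0, Hd; [reflexivity|exact Ht|lra].
  - exists d, alpha, beta, Xt, Wt.
    repeat match goal with |- _ /\ _ => split end; auto.
    + intros t Ht. assert (Ht' : Rabs t < eps) by lra.
      split; [|split];
        [ apply (smooth_strip_section eps (fun t s => px (G t s)))
        | apply (smooth_strip_section eps (fun t s => py (G t s)))
        | apply (smooth_strip_section eps (fun t s => pz (G t s))) ]; assumption.
    + apply vC1_strip_shrink with eps; assumption.
    + apply vC1_strip_shrink with eps; assumption.
    + intro s. unfold Xt.
      rewrite !(dt_ds_comm eps) by assumption.
      unfold ds, vderive. f_equal; apply Derive_ext; intro; auto.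
    + intro s. unfold Wt.
      rewrite !(dt_ds_ds_comm eps) by assumption.
      unfold ds, vderive. f_equal; apply Derive_ext; intro; apply Derive_ext; intro; auto.
    + intros t s Ht. apply Hd. lra.
Qed.

(** * The first variation of the bending energy *)

Definition regular (g : R -> E3) : Prop := forall s, 0 < dot (vderive g s) (vderive g s).

Lemma speed_sqr (g : R -> E3) (s : R) : speed g s * speed g s = dot (vderive g s) (vderive g s).
Proof. apply enorm_sqr. Qed.

Lemma speed_pos (g : R -> E3) (s : R) : regular g -> 0 < speed g s.
Proof. intro H. apply sqrt_lt_R0, H. Qed.

Lemma smooth_inv_speed (g : R -> E3) : vsmooth g -> regular g -> smooth (fun s => / speed g s).
Proof.
  intros Hg Hr. apply smooth_inv.
  - intro s. pose proof (speed_pos g s Hr). lra.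
  - apply smooth_sqrt; [exact Hr|]. apply smooth_dot; apply vsmooth_vderive, Hg.
Qed.

Lemma vsmooth_tangent (g : R -> E3) : vsmooth g -> regular g -> vsmooth (tangent g).
Proof.
  intros Hg Hr. apply vsmooth_scal; [now apply smooth_inv_speed | now apply vsmooth_vderive].
Qed.

Lemma tangent_unit (g : R -> E3) (s : R) : regular g -> dot (tangent g s) (tangent g s) = 1.
Proof.
  intro Hr. unfold tangent, vdds. rewrite dot_scal_l, dot_scal_r, <- speed_sqr.
  pose proof (speed_pos g s Hr). field. lra.
Qed.

Lemma is_derive_inv_speed (g : R -> E3) (s : R) : vsmooth g -> regular g ->
  is_derive (fun s => / speed g s) s
    (- dot (vderive g s) (vderive (vderive g) s) / speed g s ^ 3).
Proof.
  intros Hg Hr. pose proof (vsmooth_is_vderive _ s (vsmooth_vderive _ Hg)) as HX.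
  pose proof (speed_pos g s Hr).
  eapply is_derive_eq.
  - apply (is_derive_inv (speed g)); [|lra].
    apply (is_derive_sqrt (fun s => dot (vderive g s) (vderive g s))); [|apply Hr].
    apply is_derive_dot; exact HX.
  - change (sqrt (dot (vderive g s) (vderive g s))) with (speed g s).
    rewrite (dot_comm (vderive (vderive g) s)). field. lra.
Qed.

(** This is curvature squared times speed, that is [|X x W|^2 / |X|^5] for [X = g'] and [W = g''].
    Scalar products and inverse speeds are the building blocks to which the strip calculus
    applies. *)
Lemma bending_integrand (g : R -> E3) (s : R) : vsmooth g -> regular g ->
  dot (vdds g (tangent g) s) (vdds g (tangent g) s) * speed g s =
  (dot (vderive g s) (vderive g s) * dot (vderive (vderive g) s) (vderive (vderive g) s)
   - dot (vderive g s) (vderive (vderive g) s) * dot (vderive g s) (vderive (vderive g) s))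
  * (/ speed g s * / speed g s * / speed g s * / speed g s * / speed g s).
Proof.
  intros Hg Hr. unfold vdds at 1 2.
  rewrite (is_vderive_unique (tangent g) s _
    (is_vderive_scal _ _ s _ _ (is_derive_inv_speed g s Hg Hr)
       (vsmooth_is_vderive _ s (vsmooth_vderive _ Hg)))).
  rewrite !dot_scal_l, !dot_scal_r, !dot_plus_l, !dot_plus_r, !dot_scal_l, !dot_scal_r.
  rewrite (dot_comm (vderive (vderive g) s) (vderive g s)).
  rewrite <- speed_sqr. pose proof (speed_pos g s Hr). field. lra.
Qed.

Lemma arclength_orthogonal (g : R -> E3) (s : R) :
  vsmooth g -> (forall s, speed g s = 1) -> dot (vderive g s) (vderive (vderive g) s) = 0.
Proof.
  intros Hg Hs.
  pose proof (vsmooth_is_vderive _ s (vsmooth_vderive _ Hg)) as HX.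
  pose proof (is_derive_unique _ _ _ (is_derive_dot _ _ _ _ _ HX HX)) as E.
  rewrite (Derive_ext _ (fun _ => 1)), Derive_const in E.
  - rewrite (dot_comm (vderive (vderive g) s)) in E. lra.
  - intro x. apply enorm_eq_1, Hs.
Qed.

Lemma arclength_regular (g : R -> E3) : (forall s, speed g s = 1) -> regular g.
Proof. intros H s. specialize (H s). apply enorm_eq_1 in H. rewrite H. lra. Qed.

(** With [X] and [W] as above, at [t = 0] the speed is 1 and both [<X, W>] and [<X, v'>] vanish.
    This removes every term that comes from the speed or from [<X, W>^2], and leaves twice
    [rho <W, v''>], halved by the factor of the energy. *)
Lemma bending_energy_is_derive (L : R) (rho : R -> R) (g v : R -> E3) (G : R -> R -> E3) :
  0 < L -> vsmooth g -> (forall s, speed g s = 1) -> smooth rho ->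
  (forall s, 0 <= s <= L -> dot (vderive v s) (vderive g s) = 0) ->
  variation L g v G ->
  is_derive (fun t => bending_energy rho L (G t)) 0
    (RInt (fun s => rho s * dot (vderive (vderive g) s) (vderive (vderive v) s)) 0 L).
Proof.
  intros HL Hg Hs Hrho Hv HG.
  destruct (variation_jets L g v G Hg Hs HG)
    as (d & al & be & Xt & Wt & Hd & _ & _ & _ & G0 & Gsm & CX & CW & X0 & W0 & _ & Hpos).
  assert (E0 : G 0 = g) by (apply functional_extensionality; exact G0).
  set (X := fun t s => vderive (G t) s) in *.
  set (W := fun t s => vderive (vderive (G t)) s) in *.
  pose proof (C1_strip_inv d (fun t s => speed (G t) s) _
    (fun t s Ht => sqrt_lt_R0 _ (Hpos t s Ht))
    (C1_strip_sqrt d _ _ Hpos (C1_strip_dot d _ _ _ _ CX CX))) as Cs.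
  pose proof (C1_strip_mult d _ _ _ _ (C1_strip_section d rho (smooth_continuous _ Hrho))
    (C1_strip_mult d _ _ _ _
      (C1_strip_minus d _ _ _ _
         (C1_strip_mult d _ _ _ _ (C1_strip_dot d _ _ _ _ CX CX) (C1_strip_dot d _ _ _ _ CW CW))
         (C1_strip_mult d _ _ _ _ (C1_strip_dot d _ _ _ _ CX CW) (C1_strip_dot d _ _ _ _ CX CW)))
      (C1_strip_mult d _ _ _ _ (C1_strip_mult d _ _ _ _ (C1_strip_mult d _ _ _ _
         (C1_strip_mult d _ _ _ _ Cs Cs) Cs) Cs) Cs))) as C.
  pose proof (C1_strip_ex_RInt d 0 L _ _ Hd C) as Cint.
  apply (C1_strip_is_derive_RInt d 0 L _ _ Hd) in C.
  apply (is_derive_scal _ _ (/ 2)) in C.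
  eapply is_derive_eq; [eapply is_derive_ext_loc; [|exact C]|].
  - apply filter_imp with (2 := locally_strip d 0 ltac:(rewrite Rabs_R0; exact Hd)).
    intros t Ht. unfold bending_energy. f_equal. symmetry. apply RInt_ext. intros s _.
    rewrite (Rmult_assoc (rho s)), bending_integrand; [reflexivity|auto|].
    intro x. apply Hpos, Ht.
  - rewrite RInt_Rmult_l by exact Cint.
    apply RInt_ext. intros s Hs'.
      rewrite Rmin_left, Rmax_right in Hs' by lra.
      unfold X, W. rewrite E0, Hs, X0, W0.
      pose proof (proj1 (enorm_eq_1 _) (Hs s)) as HT.
      pose proof (arclength_orthogonal g s Hg Hs) as HO.
      rewrite (dot_comm (vderive g s) (vderive v s)), Hv by lra.
      change (sqrt (dot (vderive g s) (vderive g s))) with (speed g s).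
      rewrite Hs, HT, HO, (dot_comm (vderive (vderive v) s) (vderive (vderive g) s)).
      unfold scal; simpl; unfold mult; simpl. field.
Qed.

(** * A direction transversal to a closed curve *)

Lemma pigeonhole (N M : nat) (P : nat -> nat -> Prop) :
  (M < N)%nat -> (forall n, (n < N)%nat -> exists k, (k < M)%nat /\ P n k) ->
  exists n n' k, (n < N)%nat /\ (n' < N)%nat /\ n <> n' /\ P n k /\ P n' k.
Proof.
  intros HMN H. apply NNPP. intro Hno.
  destruct (functional_choice (fun n k => (n < N)%nat -> (k < M)%nat /\ P n k)) as [f Hf].
  { intro n. destruct (classic (n < N)%nat) as [Hn|Hn].
    - destruct (H n Hn) as [k Hk]. exists k. auto.
    - exists 0%nat. tauto. }
  assert (Hnd : NoDup (map f (seq 0 N))).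
  { apply NoDup_map_NoDup_ForallPairs; [|apply seq_NoDup].
    intros a b Ha Hb E. apply in_seq in Ha, Hb. apply NNPP. intro Hab.
    destruct (Hf a ltac:(lia)) as [_ H1], (Hf b ltac:(lia)) as [_ H2].
    apply Hno. exists a, b, (f a). rewrite E in H1 |- *. repeat split; auto; lia. }
  assert (Hincl : incl (map f (seq 0 N)) (seq 0 M)).
  { intros k Hk. apply in_map_iff in Hk. destruct Hk as [n [<- Hn]].
    apply in_seq in Hn. apply in_seq. destruct (Hf n ltac:(lia)). lia. }
  pose proof (NoDup_incl_length Hnd Hincl) as Hl.
  rewrite length_map, !length_seq in Hl. lia.
Qed.

Lemma periodic_nat {A : Type} (L : R) (f : R -> A) (n : nat) (s : R) :
  periodic L f -> f (s + INR n * L) = f s.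
Proof.
  intro H. induction n as [|n IH].
  - f_equal. simpl. ring.
  - rewrite S_INR. replace (s + (INR n + 1) * L) with ((s + INR n * L) + L) by ring.
    rewrite H. exact IH.
Qed.

Lemma periodic_reduce {A : Type} (L : R) (f : R -> A) (s : R) :
  0 < L -> periodic L f -> exists s', 0 <= s' < L /\ f s' = f s.
Proof.
  intros HL H. set (z := Int_part (s / L)). exists (s - IZR z * L).
  destruct (base_Int_part (s / L)) as [B1 B2]. fold z in B1, B2.
  assert (E : s / L * L = s) by (field; lra).
  split; [split; nra|].
  destruct (Z_le_gt_dec 0 z) as [Hz|Hz].
  - rewrite <- (periodic_nat L f (Z.to_nat z) (s - IZR z * L) H).
    rewrite INR_IZR_INZ, Z2Nat.id by exact Hz. f_equal. ring.
  - rewrite <- (periodic_nat L f (Z.to_nat (- z)) s H).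
    rewrite INR_IZR_INZ, Z2Nat.id, opp_IZR by lia. f_equal. ring.
Qed.

Lemma lipschitz_of_derive (f : R -> R) (K a b s s' : R) :
  smooth f -> (forall x, a <= x <= b -> Rabs (Derive f x) <= K) ->
  a <= s <= b -> a <= s' <= b -> Rabs (f s - f s') <= K * Rabs (s - s').
Proof.
  intros Hf HK Hs Hs'.
  destruct (MVT_gen f s' s (Derive f)) as [c [Hc E]].
  - intros x _. apply smooth_is_derive, Hf.
  - intros x _. apply continuity_pt_filterlim, smooth_continuous, Hf.
  - rewrite E, Rabs_mult. apply Rmult_le_compat_r; [apply Rabs_pos|].
    apply HK. revert Hc. unfold Rmin, Rmax. destruct (Rle_dec s' s); lra.
Qed.

(** From [|x| <= x^2 + 1]. Only the existence of bounds matters, so square roots are avoided. *)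
Lemma dot_self_bounds (u : E3) (D : R) :
  dot u u <= D -> Rabs (px u) <= D + 1 /\ Rabs (py u) <= D + 1 /\ Rabs (pz u) <= D + 1.
Proof.
  unfold dot. intro H. repeat split; apply Rabs_le; nra.
Qed.

(** Here [(p - p') z = (x - x') - p' (z - z')], which is at most [2 d] in absolute value, while
    [|z| >= 1/2]. It says that close unit tangents with slopes in [[0, 1]] have close slopes. *)
Lemma slope_close (x x' z z' p p' d : R) :
  x = p * z -> x' = p' * z' -> 0 <= p' <= 1 -> 1 <= 4 * (z * z) ->
  Rabs (x - x') <= d -> Rabs (z - z') <= d -> Rabs (p - p') <= 4 * d.
Proof.
  intros -> -> Hp Hz H1 H2.
  assert (Hz2 : / 2 <= Rabs z).
  { rewrite <- (Rabs_pos_eq (/ 2)) by lra. apply Rsqr_le_abs_0. unfold Rsqr. lra. }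
  assert (E : (p - p') * z = (p * z - p' * z') - p' * (z - z')) by ring.
  assert (B : Rabs (p - p') * Rabs z <= 2 * d).
  { rewrite <- Rabs_mult, E. eapply Rle_trans; [apply Rabs_triang|].
    rewrite Rabs_Ropp, Rabs_mult, (Rabs_pos_eq p') by lra.
    pose proof (Rabs_pos (z - z')). nra. }
  pose proof (Rabs_pos (p - p')). nra.
Qed.

(* Otherwise each direction (i/m, j/m, 1), 0 <= i, j < m, is parallel to some
   T(s).  Cutting [0, L) into O(m) < m^2 pieces, two of these directions, which
   are at distance at least 1/m, would be hit from the same piece; but T moves
   by O(1/m) with a small constant there. *)
Lemma exists_transversal_direction (L : R) (T : R -> E3) :
  0 < L -> periodic L T -> vsmooth T -> (forall s, dot (T s) (T s) = 1) ->
  exists e, forall s, 0 < dot (cross (T s) e) (cross (T s) e).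
Proof.
  intros HL HT Tsm Hunit. apply NNPP. intro Hno.
  assert (Hhit : forall e, exists s, 0 <= s < L /\ cross (T s) e = zero).
  { intro e. apply NNPP. intro Hn. apply Hno. exists e. intro s.
    destruct (periodic_reduce L T s HL HT) as [s' [Hs' E]]. rewrite <- E.
    destruct (dot_self_ge_0 (cross (T s') e)) as [Hlt|Heq]; [exact Hlt|].
    exfalso. apply Hn. exists s'. split; [exact Hs'|].
    apply dot_self_eq_0. symmetry. exact Heq. }
  assert (HK : exists K, 0 <= K /\ forall s, 0 <= s <= L ->
     Rabs (Derive (fun x => px (T x)) s) <= K /\
     Rabs (Derive (fun x => py (T x)) s) <= K /\
     Rabs (Derive (fun x => pz (T x)) s) <= K).
  { destruct (continuity_ab_maj (fun s => dot (vderive T s) (vderive T s)) 0 L)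
      as [mx [Hmx _]]; [lra| |].
    - intros s _. apply continuity_pt_filterlim, smooth_continuous.
      apply smooth_dot; apply vsmooth_vderive, Tsm.
    - exists (dot (vderive T mx) (vderive T mx) + 1). split.
      + pose proof (dot_self_ge_0 (vderive T mx)). lra.
      + intros s Hs. exact (dot_self_bounds (vderive T s) _ (Hmx s Hs)). }
  destruct HK as [K [HK0 HK]]. destruct Tsm as (S1 & S2 & S3).
  assert (HA : exists A : nat, (0 < A)%nat /\ 4 * K * L < INR A).
  { exists (Z.to_nat (up (4 * K * L))).
    destruct (archimed (4 * K * L)) as [A1 _].
    assert (0 <= 4 * K * L) by (apply Rmult_le_pos; [lra|lra]).
    assert (0 < up (4 * K * L))%Z by (apply lt_IZR; lra).
    split; [lia|]. rewrite INR_IZR_INZ, Z2Nat.id by lia. lra. }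
  destruct HA as [A [HA0 HA]].
  (* [m = A + 1] gives [A m < m^2], as the pigeonhole needs. On a piece of length [L / M] a
     coordinate of [T] moves by at most [K L / (A m)]; the condition [4 K L < A] absorbs the factor
     4 of [slope_close] and keeps slopes closer than [1 / m]. *)
  set (m := S A). set (M := (A * m)%nat).
  assert (Hm0 : 0 < INR m) by (apply lt_0_INR; unfold m; lia).
  assert (HM0 : 0 < INR M) by (apply lt_0_INR; unfold M, m; lia).
  set (dir := fun n : nat => vec (INR (n / m) / INR m) (INR (n mod m) / INR m) 1).
  destruct (pigeonhole (m * m) M (fun n k => exists s, 0 <= s < L /\
      cross (T s) (dir n) = zero /\ INR k <= s * INR M / L < INR k + 1))
    as (n & n' & k & Hn & Hn' & Hne & (s & Hs & Hc & Hk) & (s' & Hs' & Hc' & Hk')).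
  { unfold M, m. nia. }
  { intros n _. destruct (Hhit (dir n)) as [s [Hs Hc]].
    assert (0 <= s * INR M / L < INR M).
    { split; [apply Rdiv_le_0_compat; [nra|lra]|].
      apply Rmult_lt_reg_r with L; [lra|]. unfold Rdiv. rewrite Rmult_assoc, Rinv_l by lra. nra. }
    destruct (base_Int_part (s * INR M / L)) as [B1 B2].
    set (z := Int_part (s * INR M / L)) in *.
    assert (-1 < z)%Z by (apply lt_IZR; lra).
    assert (EZ : INR (Z.to_nat z) = IZR z) by (rewrite INR_IZR_INZ, Z2Nat.id by lia; reflexivity).
    exists (Z.to_nat z). split.
    - apply INR_lt. lra.
    - exists s. rewrite EZ. repeat split; auto; lra. }
  assert (Hss : Rabs (s - s') <= L / INR M).
  { replace (s - s') with ((s * INR M / L - s' * INR M / L) * (L / INR M)) by (field; lra).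
    rewrite Rabs_mult, (Rabs_pos_eq (L / INR M)) by (apply Rdiv_le_0_compat; lra).
    rewrite <- (Rmult_1_l (L / INR M)) at 2.
    apply Rmult_le_compat_r; [apply Rdiv_le_0_compat; lra|]. apply Rabs_le. lra. }
  assert (Hlip : forall f, smooth f -> (forall x, 0 <= x <= L -> Rabs (Derive f x) <= K) ->
            Rabs (f s - f s') <= K * (L / INR M)).
  { intros f Hf Hb. eapply Rle_trans; [apply (lipschitz_of_derive f K 0 L); auto; lra|].
    apply Rmult_le_compat_l; [exact HK0|exact Hss]. }
  pose proof (Hlip _ S1 (fun x Hx => proj1 (HK x Hx))) as LX.
  pose proof (Hlip _ S2 (fun x Hx => proj1 (proj2 (HK x Hx)))) as LY.
  pose proof (Hlip _ S3 (fun x Hx => proj2 (proj2 (HK x Hx)))) as LZ.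
  assert (Hsmall : 4 * (K * (L / INR M)) < / INR m).
  { unfold M. rewrite mult_INR. pose proof (lt_0_INR _ HA0).
    replace (4 * (K * (L / (INR A * INR m)))) with ((4 * K * L / INR A) * / INR m)
      by (field; lra).
    rewrite <- (Rmult_1_l (/ INR m)) at 2.
    apply Rmult_lt_compat_r; [apply Rinv_0_lt_compat, Hm0|].
    apply Rmult_lt_reg_r with (INR A); [lra|].
      unfold Rdiv. rewrite Rmult_assoc, Rinv_l by lra. lra. }
  assert (Hcoord : forall i, (i < m)%nat -> 0 <= INR i / INR m <= 1).
  { intros i Hi. pose proof (pos_INR i). apply lt_INR in Hi. split.
    - apply Rdiv_le_0_compat; lra.
    - apply Rmult_le_reg_r with (INR m); [lra|].
      unfold Rdiv. rewrite Rmult_assoc, Rinv_l by lra. lra. }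
  assert (Hdist : forall i j, Rabs (INR i / INR m - INR j / INR m) < / INR m -> i = j).
  { intros i j H. replace (INR i / INR m - INR j / INR m) with ((INR i - INR j) * / INR m) in H
      by (field; lra).
    rewrite Rabs_mult, (Rabs_pos_eq (/ INR m)) in H by (apply Rlt_le, Rinv_0_lt_compat, Hm0).
    assert (H1 : Rabs (INR i - INR j) < 1).
    { apply Rmult_lt_reg_r with (/ INR m); [apply Rinv_0_lt_compat, Hm0|]. lra. }
    rewrite !INR_IZR_INZ, <- minus_IZR in H1. apply Rabs_def2 in H1. destruct H1 as [H1 H2].
    apply lt_IZR in H1. apply (lt_IZR (-1)) in H2. lia. }
  assert (Hpar : forall n s, (n < m * m)%nat -> cross (T s) (dir n) = zero ->
     px (T s) = INR (n / m) / INR m * pz (T s) /\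
     py (T s) = INR (n mod m) / INR m * pz (T s) /\ 1 <= 4 * (pz (T s) * pz (T s)) /\
     0 <= INR (n / m) / INR m <= 1 /\ 0 <= INR (n mod m) / INR m <= 1).
  { intros n0 s0 Hn0 Hz.
    assert (P : 0 <= INR (n0 / m) / INR m <= 1)
      by (apply Hcoord, Nat.Div0.div_lt_upper_bound; lia).
    assert (Q : 0 <= INR (n0 mod m) / INR m <= 1)
      by (apply Hcoord, Nat.mod_upper_bound; unfold m; lia).
    pose proof (Hunit s0) as Hu. unfold dot in Hu. unfold dir in Hz.
    set (p := INR (n0 / m) / INR m) in *. set (q := INR (n0 mod m) / INR m) in *.
    assert (X : px (T s0) = p * pz (T s0)).
    { pose proof (f_equal py Hz) as Hy.
      change (pz (T s0) * p - px (T s0) * 1 = 0) in Hy. lra. }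
    assert (Y : py (T s0) = q * pz (T s0)).
    { pose proof (f_equal px Hz) as Hy.
      change (py (T s0) * 1 - pz (T s0) * q = 0) in Hy. lra. }
    (* With [z] the last coordinate, the unit length reads [(p^2 + q^2 + 1) z^2 = 1], and [p, q] lie
       in [[0, 1]], so [3 z^2 >= 1]. *)
    repeat split; try tauto. rewrite X, Y in Hu.
    pose proof (Rle_0_sqr (pz (T s0))) as H0. unfold Rsqr in H0.
    assert (p * p <= 1) by nra. assert (q * q <= 1) by nra.
    set (z2 := pz (T s0) * pz (T s0)) in *.
    replace (p * pz (T s0) * (p * pz (T s0)) + q * pz (T s0) * (q * pz (T s0)) + z2)
      with (p * p * z2 + q * q * z2 + z2) in Hu by (unfold z2; ring).
    nra. }
  destruct (Hpar n s Hn Hc) as (X1 & Y1 & Z1 & _ & _).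
  destruct (Hpar n' s' Hn' Hc') as (X2 & Y2 & _ & P2 & Q2).
  apply Hne. rewrite (Nat.div_mod_eq n m), (Nat.div_mod_eq n' m).
  rewrite (Hdist (n / m)%nat (n' / m)%nat), (Hdist (n mod m)%nat (n' mod m)%nat).
  - reflexivity.
  - eapply Rle_lt_trans; [|exact Hsmall].
    exact (slope_close _ _ _ _ _ _ _ Y1 Y2 Q2 Z1 LY LZ).
  - eapply Rle_lt_trans; [|exact Hsmall].
    exact (slope_close _ _ _ _ _ _ _ X1 X2 P2 Z1 LX LZ).
Qed.

(** * Parallel normal fields *)

Lemma derive_const_zero (f : R -> R) (s l c : R) :
  (forall x, f x = c) -> is_derive f s l -> l = 0.
Proof.
  intros Hc H. rewrite <- (is_derive_unique _ _ _ H), (Derive_ext _ (fun _ => c)) by exact Hc.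
  apply Derive_const.
Qed.

Lemma vderive_orthogonal (U : R -> E3) (c s : R) :
  vsmooth U -> (forall x, dot (U x) (U x) = c) -> dot (vderive U s) (U s) = 0.
Proof.
  intros HU Hc. pose proof (vsmooth_is_vderive U s HU) as H.
  pose proof (derive_const_zero _ _ _ _ Hc (is_derive_dot _ _ _ _ _ H H)) as E.
  rewrite (dot_comm (U s)) in E. lra.
Qed.

Lemma vderive_antisym (U V : R -> E3) (c s : R) :
  vsmooth U -> vsmooth V -> (forall x, dot (U x) (V x) = c) ->
  dot (vderive U s) (V s) = - dot (U s) (vderive V s).
Proof.
  intros HU HV Hc.
  pose proof (derive_const_zero _ _ _ _ Hc
    (is_derive_dot _ _ _ _ _ (vsmooth_is_vderive U s HU) (vsmooth_is_vderive V s HV))).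
  lra.
Qed.

Definition rotated (psi : R -> R) (N B : R -> E3) (s : R) : E3 :=
  plus (scal (cos (psi s)) (N s)) (scal (sin (psi s)) (B s)).

Lemma vsmooth_rotated (psi : R -> R) (N B : R -> E3) :
  smooth psi -> vsmooth N -> vsmooth B -> vsmooth (rotated psi N B).
Proof.
  intros Hp HN HB. apply vsmooth_plus; apply vsmooth_scal; auto using smooth_cos, smooth_sin.
Qed.

(** Let [B = T x N] and [w = <N', B>]. Modulo [T], [N' = w B] and [B' = - w N], so the normal part
    of the derivative of [cos psi N + sin psi B] is [psi' + w] times a unit vector. It vanishes
    exactly when [psi' = - w]. *)
Lemma rotated_parallel (L : R) (g N : R -> E3) (psi : R -> R) :
  vsmooth g -> regular g -> vsmooth N -> smooth psi ->
  (forall s, dot (N s) (N s) = 1) -> (forall s, dot (tangent g s) (N s) = 0) ->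
  (forall s, is_derive psi s (- dot (vderive N s) (cross (tangent g s) (N s)))) ->
  parallel_normal_field L g (rotated psi N (fun s => cross (tangent g s) (N s))).
Proof.
  intros Hg Hr HN Hp NN TN Hpsi.
  pose proof (vsmooth_tangent g Hg Hr) as HT.
  assert (TT := fun s => tangent_unit g s Hr).
  set (T := tangent g) in *. set (B := fun s => cross (T s) (N s)) in *.
  assert (HB : vsmooth B) by (apply vsmooth_cross; assumption).
  assert (BB : forall s, dot (B s) (B s) = 1).
  { intro s. unfold B. rewrite dot_cross_cross, TT, NN, (dot_comm (N s)), TN. ring. }
  assert (BN : forall s, dot (B s) (N s) = 0) by (intro; apply dot_cross_same_r).
  assert (BT : forall s, dot (B s) (T s) = 0) by (intro; apply dot_cross_same_l).
  set (Z := rotated psi N B).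
  assert (HZ : vsmooth Z) by (apply vsmooth_rotated; assumption).
  split; [exact HZ|]. split.
  - intros s _. unfold Z, rotated.
    rewrite dot_plus_l, !dot_scal_l, (dot_comm (N s)), TN, BT. ring.
  (* The multiplier can only be the tangential component of [Z']; what remains is that [Z'] has no
     component along [N] and [B]. *)
  - exists (fun s => dot (vderive Z s) (T s)). split.
    { apply smooth_dot; [apply vsmooth_vderive, HZ|exact HT]. }
    intros s _. apply minus_zero_eq.
    assert (E : vderive Z s = plus
      (plus (scal (- sin (psi s) * - dot (vderive N s) (B s)) (N s))
            (scal (cos (psi s)) (vderive N s)))
      (plus (scal (cos (psi s) * - dot (vderive N s) (B s)) (B s))
            (scal (sin (psi s)) (vderive B s)))).
    { apply is_vderive_unique.
      apply (is_vderive_plus (fun s => scal (cos (psi s)) (N s))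
               (fun s => scal (sin (psi s)) (B s)));
        [ apply (is_vderive_scal (fun s => cos (psi s)))
        | apply (is_vderive_scal (fun s => sin (psi s))) ].
      - eapply is_derive_eq; [exact (is_derive_comp cos psi s _ _ (is_derive_cos _) (Hpsi s))|].
        unfold scal; simpl; unfold mult; simpl. apply Rmult_comm.
      - apply vsmooth_is_vderive, HN.
      - eapply is_derive_eq; [exact (is_derive_comp sin psi s _ _ (is_derive_sin _) (Hpsi s))|].
        unfold scal; simpl; unfold mult; simpl. apply Rmult_comm.
      - apply vsmooth_is_vderive, HB. }
    pose proof (vderive_orthogonal N 1 s HN NN) as N1.
    pose proof (vderive_orthogonal B 1 s HB BB) as B1.
    pose proof (vderive_antisym B N 0 s HB HN BN) as BN1.
    rewrite (dot_comm (B s) (vderive N s)) in BN1.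
    apply (orthonormal_zero (T s) (N s)); auto; rewrite dot_minus_l, dot_scal_l.
    + rewrite TT. ring.
    + rewrite TN, E, !dot_plus_l, !dot_scal_l, N1, NN, BN, BN1. ring.
    + fold (B s). rewrite (dot_comm (T s)), BT, E, !dot_plus_l, !dot_scal_l, BB, B1.
      rewrite (dot_comm (N s)), BN. ring.
Qed.

(** * The normal frame of a fixed direction *)

Lemma is_vderive_cross_const (f : R -> E3) (e : E3) (s : R) (df : E3) :
  is_vderive f s df -> is_vderive (fun x => cross (f x) e) s (cross df e).
Proof.
  intro H. eapply is_vderive_eq; [apply is_vderive_cross; [exact H|apply is_vderive_const]|].
  vring.
Qed.

Definition gauge (g : R -> E3) (e : E3) (s : R) : R :=
  dot (cross (vderive g s) e) (cross (vderive g s) e).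

Definition frame_normal (g : R -> E3) (e : E3) (s : R) : E3 :=
  scal (/ sqrt (gauge g e s)) (cross (vderive g s) e).

(** The rate [<N', T x N>] at which the frame normal [N] turns, with the square root of [gauge]
    eliminated; [frame_rotation_eq] is the justification. In this form the strip calculus applies to
    it. *)
Definition frame_rotation (g : R -> E3) (e : E3) (s : R) : R :=
  dot (vderive g s) e * dot (cross (vderive (vderive g) s) e) (vderive g s)
  * (/ speed g s * / gauge g e s).

Definition transversal (g : R -> E3) (e : E3) : Prop := forall s, 0 < gauge g e s.

Lemma smooth_gauge (g : R -> E3) (e : E3) : vsmooth g -> smooth (gauge g e).
Proof.
  intro Hg. apply smooth_dot; apply vsmooth_cross; auto using vsmooth_const, vsmooth_vderive.
Qed.

Lemma vsmooth_frame_normal (g : R -> E3) (e : E3) :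
  vsmooth g -> transversal g e -> vsmooth (frame_normal g e).
Proof.
  intros Hg He. apply vsmooth_scal.
  - apply smooth_inv; [|apply smooth_sqrt; [exact He|now apply smooth_gauge]].
    intro s. pose proof (sqrt_lt_R0 _ (He s)). lra.
  - apply vsmooth_cross; auto using vsmooth_const, vsmooth_vderive.
Qed.

Lemma frame_normal_unit (g : R -> E3) (e : E3) (s : R) :
  transversal g e -> dot (frame_normal g e s) (frame_normal g e s) = 1.
Proof.
  intro He. unfold frame_normal. rewrite dot_scal_l, dot_scal_r. fold (gauge g e s).
  pose proof (sqrt_lt_R0 _ (He s)).
  rewrite <- (sqrt_sqrt (gauge g e s)) at 3 by (apply Rlt_le, He). field. lra.
Qed.

Lemma frame_normal_orthogonal (g : R -> E3) (e : E3) (s : R) :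
  dot (tangent g s) (frame_normal g e s) = 0.
Proof.
  unfold tangent, vdds, frame_normal.
  rewrite dot_scal_l, dot_scal_r, dot_comm, dot_cross_same_l. ring.
Qed.

Lemma smooth_frame_rotation (g : R -> E3) (e : E3) :
  vsmooth g -> regular g -> transversal g e -> smooth (frame_rotation g e).
Proof.
  intros Hg Hr He.
  pose proof (vsmooth_vderive _ Hg) as HX. pose proof (vsmooth_vderive _ HX) as HW.
  apply smooth_mult; apply smooth_mult.
  - apply smooth_dot; auto using vsmooth_const.
  - apply smooth_dot; auto. apply vsmooth_cross; auto using vsmooth_const.
  - now apply smooth_inv_speed.
  - apply smooth_inv; [|now apply smooth_gauge]. intro s. specialize (He s). lra.
Qed.

Lemma frame_rotation_eq (g : R -> E3) (e : E3) (s : R) :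
  vsmooth g -> regular g -> transversal g e ->
  dot (vderive (frame_normal g e) s) (cross (tangent g s) (frame_normal g e s))
  = frame_rotation g e s.
Proof.
  intros Hg Hr He.
  pose proof (vsmooth_is_vderive _ s (vsmooth_vderive _ Hg)) as HX.
  pose proof (sqrt_lt_R0 _ (He s)) as Hq. pose proof (speed_pos g s Hr) as Hs.
  assert (Sc : smooth (fun s => / sqrt (gauge g e s))).
  { apply smooth_inv; [|apply smooth_sqrt; [exact He|now apply smooth_gauge]].
    intro x. pose proof (sqrt_lt_R0 _ (He x)). lra. }
  assert (E : vderive (frame_normal g e) s = plus
    (scal (Derive (fun s => / sqrt (gauge g e s)) s) (cross (vderive g s) e))
    (scal (/ sqrt (gauge g e s)) (cross (vderive (vderive g) s) e))).
  { apply is_vderive_unique.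
    apply (is_vderive_scal (fun s => / sqrt (gauge g e s)) (fun s => cross (vderive g s) e)).
    - apply smooth_is_derive, Sc.
    - now apply is_vderive_cross_const. }
  rewrite E. clear E Sc. unfold frame_normal, tangent, vdds, frame_rotation.
  replace (/ gauge g e s) with (/ (sqrt (gauge g e s) * sqrt (gauge g e s)))
    by (now rewrite sqrt_sqrt by (apply Rlt_le, He)).
  (* The derivative of the normalizing factor may stay unknown: it multiplies [X x e], which is
     orthogonal to [T x N], a combination of [X] and [e]. The [e] part of [T x N] drops out of the
     other term, as [W x e] is orthogonal to [e]. *)
  generalize (Derive (fun s => / sqrt (gauge g e s)) s).
  generalize dependent (sqrt (gauge g e s)). intros r Hr0 k.
  generalize dependent (speed g s). intros v Hv.
  generalize (vderive g s) (vderive (vderive g) s). intros X W.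
  replace (cross (scal (/ v) X) (scal (/ r) (cross X e)))
    with (scal (/ v * / r) (minus (scal (dot X e) X) (scal (dot X X) e)))
    by (rewrite <- triple_cross; vring).
  rewrite dot_plus_l, !dot_scal_l, !dot_scal_r.
  rewrite !(dot_comm _ (minus _ _)), !dot_minus_l, !dot_scal_l.
  rewrite !(dot_comm X (cross _ _)), !(dot_comm e (cross _ _)).
  rewrite dot_cross_same_l, !dot_cross_same_r. field. split; lra.
Qed.

Lemma frame_parallel (L a : R) (g : R -> E3) (e : E3) :
  vsmooth g -> regular g -> transversal g e ->
  parallel_normal_field L g
    (rotated (fun s => a - RInt (frame_rotation g e) 0 s) (frame_normal g e)
       (fun s => cross (tangent g s) (frame_normal g e s))).
Proof.
  intros Hg Hr He. pose proof (smooth_frame_rotation g e Hg Hr He) as Hw.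
  apply rotated_parallel; auto using vsmooth_frame_normal, frame_normal_unit,
    frame_normal_orthogonal.
  - apply smooth_minus; [apply smooth_const|now apply smooth_antiderivative].
  - intro s. rewrite frame_rotation_eq by assumption.
    eapply is_derive_eq.
    + apply (is_derive_minus (fun _ => a)); [apply (is_derive_const a s)|].
      apply is_derive_antiderivative, smooth_continuous, Hw.
    + unfold minus, plus, opp, zero; simpl. ring.
Qed.

(** * Uniqueness of parallel transport and of the holonomy angle *)

Lemma parallel_dot_const (L : R) (g Z1 Z2 : R -> E3) :
  0 < L -> parallel_normal_field L g Z1 -> parallel_normal_field L g Z2 ->
  dot (Z1 L) (Z2 L) = dot (Z1 0) (Z2 0).
Proof.
  intros HL (S1 & N1 & l1 & _ & D1) (S2 & N2 & l2 & _ & D2).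
  symmetry. apply (eq_is_derive (fun s => dot (Z1 s) (Z2 s)) 0 L); [|exact HL].
  intros s Hs. eapply is_derive_eq.
  - apply is_derive_dot; apply vsmooth_is_vderive; assumption.
  - rewrite D1, D2, dot_scal_l, dot_scal_r, (dot_comm (tangent g s)), N1, N2 by exact Hs.
    unfold zero; simpl. ring.
Qed.

(** Parallel transport is isometric: the square of the distance of [Z1 L] and [Z2 L] expands into
    three scalar products, each of which is the same at 0. *)
Lemma parallel_unique (L : R) (g Z1 Z2 : R -> E3) :
  0 < L -> parallel_normal_field L g Z1 -> parallel_normal_field L g Z2 ->
  Z1 0 = Z2 0 -> Z1 L = Z2 L.
Proof.
  intros HL H1 H2 E. apply minus_zero_eq, dot_self_eq_0.
  pose proof (parallel_dot_const L g _ _ HL H1 H1) as E11.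
  pose proof (parallel_dot_const L g _ _ HL H1 H2) as E12.
  pose proof (parallel_dot_const L g _ _ HL H2 H2) as E22.
  rewrite dot_minus_l, (dot_comm (Z1 L)), (dot_comm (Z2 L)), !dot_minus_l.
  rewrite (dot_comm (Z2 L) (Z1 L)), E11, E12, E22, E. ring.
Qed.

(** Equality in [R/2piZ] is expressed by equal cosine and sine, the coordinates of the transported
    vector in the orthonormal pair [Wb], [T x Wb]. *)
Lemma holonomy_angle_unique (L : R) (Wa Wb : E3) (g : R -> E3) (th th' : R) :
  0 < L -> regular g -> unit_normal g L Wb ->
  holonomy_angle L Wa Wb g th -> holonomy_angle L Wa Wb g th' ->
  cos th = cos th' /\ sin th = sin th'.
Proof.
  intros HL Hr [Wu Wn] (Z & HZ & Z0 & ZL) (Z' & HZ' & Z0' & ZL').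
  apply enorm_eq_1 in Wu.
  assert (E : Z L = Z' L) by (apply (parallel_unique L g); congruence).
  rewrite ZL, ZL' in E.
  assert (BB : dot (cross (tangent g L) Wb) (cross (tangent g L) Wb) = 1).
  { rewrite dot_cross_cross, Wu, (tangent_unit g L Hr), Wn, (dot_comm _ Wb), Wn. ring. }
  assert (BW : dot (cross (tangent g L) Wb) Wb = 0) by apply dot_cross_same_r.
  split.
  - apply (f_equal (fun u => dot u Wb)) in E.
    rewrite !dot_plus_l, !dot_scal_l, Wu, BW in E. lra.
  - apply (f_equal (fun u => dot u (cross (tangent g L) Wb))) in E.
    rewrite !dot_plus_l, !dot_scal_l, BB, (dot_comm Wb), BW in E. lra.
Qed.

Lemma angle_of_unit (p q : R) : p * p + q * q = 1 -> exists a, cos a = p /\ sin a = q.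
Proof.
  intro H.
  assert (Hp : -1 <= p <= 1) by nra.
  assert (Hs : sqrt (1 - p²) = Rabs q).
  { replace (1 - p²) with (q²) by (unfold Rsqr; lra). apply sqrt_Rsqr_abs. }
  destruct (Rle_lt_dec 0 q) as [Hq|Hq].
  - exists (acos p). rewrite cos_acos, sin_acos, Hs, Rabs_pos_eq by assumption. auto.
  - exists (- acos p). rewrite cos_neg, sin_neg, cos_acos, sin_acos, Hs, Rabs_left by assumption.
    split; ring.
Qed.

Lemma normal_angle (t n w : E3) :
  dot t t = 1 -> dot n n = 1 -> dot t n = 0 -> dot w w = 1 -> dot w t = 0 ->
  exists a, w = plus (scal (cos a) n) (scal (sin a) (cross t n)).
Proof.
  intros Ht Hn Htn Hw Hwt. set (b := cross t n).
  assert (Hb : dot b b = 1).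
  { unfold b. rewrite dot_cross_cross, Ht, Hn, (dot_comm n t), Htn. ring. }
  assert (Hbn : dot b n = 0) by apply dot_cross_same_r.
  assert (Hbt : dot b t = 0) by apply dot_cross_same_l.
  set (p := dot w n). set (q := dot w b).
  assert (E : w = plus (scal p n) (scal q b)).
  { apply minus_zero_eq, (orthonormal_zero t n); auto;
      fold b; rewrite dot_minus_l, dot_plus_l, !dot_scal_l.
    - rewrite Hwt, (dot_comm n), Htn, Hbt. ring.
    - rewrite Hn, Hbn. unfold p. ring.
    - rewrite (dot_comm n), Hbn, Hb. unfold q. ring. }
  destruct (angle_of_unit p q) as [a [<- <-]].
  - rewrite E in Hw. rewrite dot_plus_l, !dot_plus_r, !dot_scal_l, !dot_scal_r in Hw.
    rewrite Hn, Hb, Hbn, (dot_comm n), Hbn in Hw. lra.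
  - exists a. exact E.
Qed.

(** On the plane orthogonal to [t], the product with [t] is a quarter turn, so angles add up. *)
Lemma rotate_sum (t n : E3) (th b : R) :
  dot t t = 1 -> dot t n = 0 ->
  let w := plus (scal (cos b) n) (scal (sin b) (cross t n)) in
  plus (scal (cos th) w) (scal (sin th) (cross t w))
  = plus (scal (cos (th + b)) n) (scal (sin (th + b)) (cross t n)).
Proof.
  intros Ht Htn w. unfold w.
  replace (cross t (plus (scal (cos b) n) (scal (sin b) (cross t n))))
    with (plus (scal (cos b) (cross t n)) (scal (sin b) (cross t (cross t n)))) by vring.
  rewrite triple_cross, Ht, Htn, cos_plus, sin_plus. vring.
Qed.

(** * The first variation of the holonomy *)

(* With alpha_X(P) = <X,e> det(P,e,X) / (|X| |X x e|^2), the rotation of the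
   frame along a curve with X = g' is alpha_X(X'), and alpha is a primitive, on
   the complement of the line spanned by e, of det(X,P,Y) / |X|^3.  This is
   d alpha (Y,P) = det(X,P,Y) / |X|^3 with denominators cleared. *)
Lemma frame_rotation_identity (X W Y e : E3) :
  let q := dot (cross X e) (cross X e) in
  let bW := dot (cross W e) X in
  let bY := dot (cross Y e) X in
  (dot Y e * bW - dot W e * bY
     + dot X e * (dot (cross W e) Y - dot (cross Y e) W)) * q * dot X X
  - dot X e * (bW * dot X Y - bY * dot X W) * q
  - 2 * dot X e * (bW * dot (cross Y e) (cross X e)
                   - bY * dot (cross W e) (cross X e)) * dot X X
  = dot (cross X W) Y * (q * q).
Proof. cbv zeta. vring. Qed.

(** With [Y = v'], the left side is the [t]-derivative of [alpha_X(W)] minus the [s]-derivative of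
    [alpha_X(Y)]. The terms in [Y'] cancel between the two, and those from the length of [X] vanish
    by orthogonality. *)
Lemma frame_rotation_identity_unit (X W Y e : E3) (q : R) :
  dot X X = 1 -> dot X Y = 0 -> dot X W = 0 ->
  q = dot (cross X e) (cross X e) -> q <> 0 ->
  dot Y e * dot (cross W e) X / q
  + dot X e * dot (cross W e) Y / q
  - dot X e * dot (cross W e) X * (2 * dot (cross Y e) (cross X e)) / (q * q)
  - (dot W e * dot (cross Y e) X / q
     + dot X e * dot (cross Y e) W / q
     - dot X e * dot (cross Y e) X * (2 * dot (cross W e) (cross X e)) / (q * q))
  = dot (cross X W) Y.
Proof.
  intros HX HY HW Eq Hq.
  pose proof (frame_rotation_identity X W Y e) as H. cbv zeta in H.
  rewrite HX, HY, HW, <- Eq in H.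
  apply Rmult_eq_reg_r with (q * q); [|now apply Rmult_integral_contrapositive].
  rewrite <- H. field. exact Hq.
Qed.

(* alpha_X(Y) along an arc-length parametrized curve *)
Definition frame_shift (g v : R -> E3) (e : E3) (s : R) : R :=
  dot (vderive g s) e * dot (cross (vderive v s) e) (vderive g s) * / gauge g e s.

Lemma is_derive_frame_shift (g v : R -> E3) (e : E3) (s : R) :
  vsmooth g -> vsmooth v -> transversal g e ->
  is_derive (frame_shift g v e) s
    ((dot (vderive (vderive g) s) e * dot (cross (vderive v s) e) (vderive g s)
      + dot (vderive g s) e * (dot (cross (vderive (vderive v) s) e) (vderive g s)
                             + dot (cross (vderive v s) e) (vderive (vderive g) s)))
       / gauge g e s
     - dot (vderive g s) e * dot (cross (vderive v s) e) (vderive g s)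
       * (2 * dot (cross (vderive (vderive g) s) e) (cross (vderive g s) e))
       / (gauge g e s * gauge g e s)).
Proof.
  intros Hg Hv He. specialize (He s).
  pose proof (vsmooth_is_vderive _ s (vsmooth_vderive _ Hg)) as HX.
  pose proof (vsmooth_is_vderive _ s (vsmooth_vderive _ Hv)) as HY.
  pose proof (is_vderive_cross_const _ e s _ HX) as HXe.
  pose proof (is_vderive_cross_const _ e s _ HY) as HYe.
  pose proof (is_derive_dot _ _ _ _ _ HX (is_vderive_const e s)) as D1.
  pose proof (is_derive_dot _ _ _ _ _ HYe HX) as D2.
  pose proof (is_derive_inv (gauge g e) s _ (is_derive_dot _ _ _ _ _ HXe HXe)
                ltac:(lra)) as D3.
  pose proof (is_derive_Rmult _ _ _ _ _ (is_derive_Rmult _ _ _ _ _ D1 D2) D3) as D4.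
  cbv beta in D4. eapply is_derive_eq; [exact D4|].
  rewrite (dot_comm (vderive g s) zero), dot_zero_l.
  rewrite (dot_comm (cross (vderive g s) e) (cross (vderive (vderive g) s) e)).
  field. lra.
Qed.

Lemma smooth_frame_shift (g v : R -> E3) (e : E3) :
  vsmooth g -> vsmooth v -> transversal g e -> smooth (frame_shift g v e).
Proof.
  intros Hg Hv He.
  pose proof (vsmooth_vderive _ Hg) as HX. pose proof (vsmooth_vderive _ Hv) as HY.
  apply smooth_mult; [apply smooth_mult|].
  - apply smooth_dot; auto using vsmooth_const.
  - apply smooth_dot; auto. apply vsmooth_cross; auto using vsmooth_const.
  - apply smooth_inv; [|now apply smooth_gauge]. intro s. specialize (He s). lra.
Qed.

Lemma vderive_supported (L : R) (v : R -> E3) :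
  0 < L -> supported_inside L v -> vderive v 0 = zero /\ vderive v L = zero.
Proof.
  intros HL (al & be & Ha & Hab & Hb & Hv).
  assert (E : forall s, s < al \/ be < s -> vderive v s = vderive (fun _ => zero) s).
  { apply vderive_agree. exact Hv. }
  assert (Z : forall s, vderive (fun _ => zero) s = zero).
  { intro s. apply is_vderive_unique, is_vderive_const. }
  rewrite !E by lra. auto.
Qed.

(** The area swept by [T] on the unit sphere, to first order. It is the derivative of the total
    frame rotation; the holonomy varies by its opposite, since parallel fields turn against the
    frame. *)
Definition holonomy_derivative (L : R) (g v : R -> E3) : R :=
  RInt (fun s => dot (cross (vderive g s) (vderive (vderive g) s)) (vderive v s)) 0 L.

(** The density varies by the total derivative of [frame_shift] plus the area density
    [det(T, T', v')]. The former integrates to 0 because [v'] vanishes at both ends, so the choice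
    of [e] leaves no trace. *)
Lemma frame_rotation_is_derive (L : R) (g v : R -> E3) (e : E3) (G : R -> R -> E3) (d : R)
  (Xt Wt : R -> R -> E3) :
  0 < L -> 0 < d -> vsmooth g -> (forall s, speed g s = 1) -> vsmooth v ->
  supported_inside L v -> transversal g e ->
  (forall s, 0 <= s <= L -> dot (vderive v s) (vderive g s) = 0) ->
  (forall s, G 0 s = g s) ->
  vC1_strip d (fun t s => vderive (G t) s) Xt ->
  vC1_strip d (fun t s => vderive (vderive (G t)) s) Wt ->
  (forall s, Xt 0 s = vderive v s) -> (forall s, Wt 0 s = vderive (vderive v) s) ->
  (forall t, Rabs t < d -> regular (G t)) ->
  (forall t, Rabs t < d -> transversal (G t) e) ->
  is_derive (fun t => RInt (frame_rotation (G t) e) 0 L) 0 (holonomy_derivative L g v).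
Proof.
  intros HL Hd Hg Hs Hv Hsupp He Hv0 G0 CX CW X0 W0 Hreg Htr.
  assert (E0 : G 0 = g) by (apply functional_extensionality; exact G0).
  set (X := fun t s => vderive (G t) s) in *.
  set (W := fun t s => vderive (vderive (G t)) s) in *.
  pose proof (vC1_strip_const d e) as Ce.
  pose proof (vC1_strip_cross d _ _ _ _ CX Ce) as CXe.
  pose proof (vC1_strip_cross d _ _ _ _ CW Ce) as CWe.
  pose proof (C1_strip_inv d (fun t s => speed (G t) s) _
    (fun t s Ht => sqrt_lt_R0 _ (Hreg t Ht s))
    (C1_strip_sqrt d _ _ (fun t s Ht => Hreg t Ht s) (C1_strip_dot d _ _ _ _ CX CX))) as Cs.
  pose proof (C1_strip_inv d (fun t s => gauge (G t) e s) _
    (fun t s Ht => Htr t Ht s) (C1_strip_dot d _ _ _ _ CXe CXe)) as Cq.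
  pose proof (C1_strip_mult d _ _ _ _
    (C1_strip_mult d _ _ _ _ (C1_strip_dot d _ _ _ _ CX Ce) (C1_strip_dot d _ _ _ _ CWe CX))
    (C1_strip_mult d _ _ _ _ Cs Cq)) as C.
  apply (C1_strip_is_derive_RInt d 0 L _ _ Hd) in C.
  eapply is_derive_eq; [exact C|]. clear C Cs Cq CXe CWe. cbv beta.
  pose proof (vsmooth_vderive _ Hg) as SX. pose proof (vsmooth_vderive _ SX) as SW.
  pose proof (vsmooth_vderive _ Hv) as SY.
  assert (Sdet : smooth (fun s => dot (cross (vderive g s) (vderive (vderive g) s)) (vderive v s))).
  { apply smooth_dot; auto. apply vsmooth_cross; auto. }
  pose proof (smooth_frame_shift g v e Hg Hv He) as Sh.
  assert (I0 : @eq R (RInt (Derive (frame_shift g v e)) 0 L) 0).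
  { rewrite (RInt_of_derive (frame_shift g v e)).
    - destruct (vderive_supported L v HL Hsupp) as [Z0 ZL].
      unfold frame_shift. rewrite Z0, ZL.
      rewrite cross_zero_l, !dot_zero_l. ring.
    - intro x. apply smooth_is_derive, Sh.
    - intro x. apply smooth_continuous, smooth_Derive, Sh. }
  unfold holonomy_derivative.
  transitivity (RInt (Derive (frame_shift g v e)) 0 L + RInt (fun s =>
    dot (cross (vderive g s) (vderive (vderive g) s)) (vderive v s)) 0 L).
  2: { rewrite I0. apply Rplus_0_l. }
  rewrite RInt_Rplus by (apply smooth_ex_RInt; auto using smooth_Derive).
  apply RInt_ext. intros s Hs'. rewrite Rmin_left, Rmax_right in Hs' by lra.
  rewrite (is_derive_unique _ _ _ (is_derive_frame_shift g v e s Hg Hv He)).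
  pose proof (proj1 (enorm_eq_1 _) (Hs s)) as HT.
  pose proof (arclength_orthogonal g s Hg Hs) as HO.
  pose proof (Hv0 s ltac:(lra)) as HY. rewrite dot_comm in HY.
  specialize (He s).
  rewrite <- (frame_rotation_identity_unit (vderive g s) (vderive (vderive g) s) (vderive v s) e
    (gauge g e s) HT HY HO eq_refl ltac:(lra)).
  unfold X, W. rewrite E0, Hs, X0, W0.
  rewrite !cross_zero_r.
  change (sqrt (dot (vderive g s) (vderive g s))) with (speed g s).
  rewrite Hs, (dot_comm (vderive v s) (vderive g s)), HY.
  rewrite !plus_zero_r, (dot_comm _ zero), dot_zero_l.
  change (dot (cross (vderive g s) e) (cross (vderive g s) e)) with (gauge g e s).
  rewrite (dot_comm (cross (vderive g s) e) (cross (vderive v s) e)).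
  match goal with |- ?a = ?b => change (@eq R a b) end. field. lra.
Qed.

Lemma tangent_congr (g h : R -> E3) (s : R) :
  vderive g s = vderive h s -> tangent g s = tangent h s.
Proof. intro E. unfold tangent, vdds, speed. now rewrite E. Qed.

Lemma frame_normal_congr (g h : R -> E3) (e : E3) (s : R) :
  vderive g s = vderive h s -> frame_normal g e s = frame_normal h e s.
Proof. intro E. unfold frame_normal, gauge. now rewrite E. Qed.

Lemma frame_holonomy_angle (L a b : R) (g : R -> E3) (e Wa Wb : E3) :
  vsmooth g -> regular g -> transversal g e ->
  let N := frame_normal g e in
  let B := fun s => cross (tangent g s) (N s) in
  Wa = plus (scal (cos a) (N 0)) (scal (sin a) (B 0)) ->
  Wb = plus (scal (cos b) (N L)) (scal (sin b) (B L)) ->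
  holonomy_angle L Wa Wb g (a - b - RInt (frame_rotation g e) 0 L).
Proof.
  intros Hg Hr He N B -> ->.
  exists (rotated (fun s => a - RInt (frame_rotation g e) 0 s) N B).
  split; [now apply frame_parallel|]. split.
  - unfold rotated. rewrite RInt_point. change (@zero R_CompleteNormedModule) with 0.
    now rewrite Rminus_0_r.
  - unfold B. rewrite rotate_sum.
    + unfold rotated. do 2 f_equal; f_equal; ring.
    + now apply tangent_unit.
    + apply frame_normal_orthogonal.
Qed.

(** The frame does not move at the ends, so the angles that [Wa] and [Wb] make with it are
    constants. They are absorbed in [c], and a single [Phi] serves all choices of [W]. The fixed end
    tangent is recorded because uniqueness of the angle needs [Wb] normal to each nearby curve. *)
Lemma variation_holonomy (L : R) (g v : R -> E3) (e : E3) (G : R -> R -> E3) :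
  0 < L -> vsmooth g -> (forall s, speed g s = 1) -> vsmooth v -> supported_inside L v ->
  transversal g e -> (forall s, 0 <= s <= L -> dot (vderive v s) (vderive g s) = 0) ->
  variation L g v G ->
  exists Phi, is_derive Phi 0 (- holonomy_derivative L g v) /\
    locally 0 (fun t => regular (G t) /\ tangent (G t) L = tangent g L) /\
    forall Wa Wb, unit_normal g 0 Wa -> unit_normal g L Wb ->
      exists c, locally 0 (fun t => holonomy_angle L Wa Wb (G t) (c + Phi t)).
Proof.
  intros HL Hg Hs Hv Hsupp He Hv0 HG.
  destruct (variation_jets L g v G Hg Hs HG)
    as (d & al & be & Xt & Wt & Hd & Hal & _ & Hbe & G0 & Gsm & CX & CW & X0 & W0 & Gout & Hpos).
  assert (E0 : G 0 = g) by (apply functional_extensionality; exact G0).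
  pose proof (vC1_strip_cross d _ _ _ _ CX (vC1_strip_const d e)) as CXe.
  pose proof (C1_strip_dot d _ _ _ _ CXe CXe) as Cq.
  destruct (strip_positive d (al / 2) ((be + L) / 2) (fun t s => gauge (G t) e s) Hd)
    as (d' & Hd' & Hdd & Htr).
  { intro s. apply (Cq 0 s). rewrite Rabs_R0. exact Hd. }
  { intro s. rewrite E0. apply He. }
  { intros t s Ht Hos. rewrite E0. unfold gauge. rewrite Gout by lra. reflexivity. }
  exists (fun t => - RInt (frame_rotation (G t) e) 0 L). split; [|split].
  - apply (is_derive_opp (fun t => RInt (frame_rotation (G t) e) 0 L)).
    apply (frame_rotation_is_derive L g v e G d' Xt Wt); auto.
    + now apply vC1_strip_shrink with d.
    + now apply vC1_strip_shrink with d.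
    + intros t Ht s. apply Hpos. lra.
    + intros t Ht s. now apply Htr.
  - apply filter_imp with (2 := locally_strip d' 0 ltac:(rewrite Rabs_R0; exact Hd')).
    intros t Ht. split.
    + intro s. apply Hpos. lra.
    + apply tangent_congr, Gout; lra.
  - pose proof (arclength_regular g Hs) as Hr.
    assert (A : forall s W, unit_normal g s W -> exists a, W = plus
        (scal (cos a) (frame_normal g e s))
        (scal (sin a) (cross (tangent g s) (frame_normal g e s)))).
    { intros s W [W1 W2]. apply enorm_eq_1 in W1.
      apply normal_angle; auto using tangent_unit, frame_normal_unit, frame_normal_orthogonal. }
    intros Wa Wb HWa HWb.
    destruct (A 0 Wa HWa) as [a Ea]. destruct (A L Wb HWb) as [b Eb].
    exists (a - b).
    apply filter_imp with (2 := locally_strip d' 0 ltac:(rewrite Rabs_R0; exact Hd')).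
    intros t Ht. apply frame_holonomy_angle.
    + apply Gsm. lra.
    + intro s. apply Hpos. lra.
    + intro s. now apply Htr.
    + rewrite (tangent_congr _ g), (frame_normal_congr _ g) by (apply Gout; lra). exact Ea.
    + rewrite (tangent_congr _ g), (frame_normal_congr _ g) by (apply Gout; lra). exact Eb.
Qed.

Lemma is_derive_cos_comp (f : R -> R) (x l : R) :
  is_derive f x l -> is_derive (fun y => cos (f y)) x (- sin (f x) * l).
Proof.
  intro H. eapply is_derive_eq; [exact (is_derive_comp cos f x _ _ (is_derive_cos _) H)|].
  apply Rmult_comm.
Qed.

Lemma is_derive_sin_comp (f : R -> R) (x l : R) :
  is_derive f x l -> is_derive (fun y => sin (f y)) x (cos (f x) * l).
Proof.
  intro H. eapply is_derive_eq; [exact (is_derive_comp sin f x _ _ (is_derive_sin _) H)|].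
  apply Rmult_comm.
Qed.

(** Nothing is known about the multiple of 2 pi by which the lifts differ at each [t].
    Differentiating cosine and sine avoids it: [l] and [m] multiply the same nonzero vector
    [(- sin, cos)]. *)
Lemma lift_derive_unique (f g : R -> R) (l m : R) :
  is_derive f 0 l -> is_derive g 0 m ->
  locally 0 (fun t => cos (f t) = cos (g t) /\ sin (f t) = sin (g t)) -> l = m.
Proof.
  intros Hf Hg H.
  destruct (locally_singleton _ _ H) as [C0 S0].
  assert (C : - sin (f 0) * l = - sin (g 0) * m).
  { rewrite <- (is_derive_unique _ _ _ (is_derive_cos_comp f 0 l Hf)).
    rewrite <- (is_derive_unique _ _ _ (is_derive_cos_comp g 0 m Hg)).
    apply Derive_ext_loc. revert H. apply filter_imp. tauto. }
  assert (S : cos (f 0) * l = cos (g 0) * m).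
  { rewrite <- (is_derive_unique _ _ _ (is_derive_sin_comp f 0 l Hf)).
    rewrite <- (is_derive_unique _ _ _ (is_derive_sin_comp g 0 m Hg)).
    apply Derive_ext_loc. revert H. apply filter_imp. tauto. }
  rewrite C0 in S. rewrite S0 in C.
  pose proof (sin2_cos2 (g 0)) as Q. unfold Rsqr in Q.
  replace l with ((sin (g 0) * sin (g 0) + cos (g 0) * cos (g 0)) * l) by (rewrite Q; ring).
  replace m with ((sin (g 0) * sin (g 0) + cos (g 0) * cos (g 0)) * m) by (rewrite Q; ring).
  replace ((sin (g 0) * sin (g 0) + cos (g 0) * cos (g 0)) * l)
    with (- sin (g 0) * (- sin (g 0) * l) + cos (g 0) * (cos (g 0) * l)) by ring.
  rewrite C, S. ring.
Qed.

(** The existence half: it verifies the holonomy constraint for a given field. *)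
Lemma holonomy_first_variation_of_derivative (L : R) (g v : R -> E3) (e Wa Wb : E3) :
  0 < L -> vsmooth g -> (forall s, speed g s = 1) -> vsmooth v -> supported_inside L v ->
  transversal g e -> (forall s, 0 <= s <= L -> dot (vderive v s) (vderive g s) = 0) ->
  unit_normal g 0 Wa -> unit_normal g L Wb ->
  holonomy_first_variation L Wa Wb g v (- holonomy_derivative L g v).
Proof.
  intros HL Hg Hs Hv Hsupp He Hv0 HWa HWb G HG.
  destruct (variation_holonomy L g v e G HL Hg Hs Hv Hsupp He Hv0 HG)
    as (Phi & HPhi & _ & Hangle).
  destruct (Hangle Wa Wb HWa HWb) as [c Hc].
  exists (fun t => c + Phi t). split; [exact Hc|].
  eapply is_derive_eq.
  - apply (is_derive_plus (fun _ => c) Phi); [apply (is_derive_const c 0)|exact HPhi].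
  - apply Rplus_0_l.
Qed.

Lemma affine_ex_diff_n (a b : R -> R) (n : nat) (t s : R) :
  smooth a -> smooth b -> ex_diff_n (fun t s => a s + t * b s) n t s.
Proof.
  revert a b t s. induction n as [|n IH]; intros a b t s Ha Hb.
  - split; [|exact I].
    apply continuity_2d_pt_plus; [|apply continuity_2d_pt_mult].
    + apply continuity_2d_pt_section_const, smooth_continuous, Ha.
    + apply continuity_2d_pt_id1.
    + apply continuity_2d_pt_section_const, smooth_continuous, Hb.
  - split; [|split; [|split; [|split]]].
    + exact (proj1 (ex_diff_n_m n 0 ltac:(lia) _ _ _ (IH a b t s Ha Hb))).
    + auto_derive. exact I.
    + apply (smooth_ex_derive (fun s => a s + t * b s)).
      apply smooth_plus; [exact Ha|apply smooth_mult; [apply smooth_const|exact Hb]].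
    (* The term [t * 0] keeps the derivative in the affine form over which the induction is
       generalized. *)
    + replace (fun u v => Derive (fun z => a v + z * b v) u) with (fun t s => b s + t * 0).
      * apply IH; [exact Hb|apply smooth_const].
      * apply functional_extensionality; intro u. apply functional_extensionality; intro w.
        symmetry. apply is_derive_unique. auto_derive; [exact I|ring].
    + replace (fun u v => Derive (fun z => a z + u * b z) v)
        with (fun t s => Derive a s + t * Derive b s).
      * apply IH; now apply smooth_Derive.
      * apply functional_extensionality; intro u. apply functional_extensionality; intro w.
        symmetry. apply is_derive_unique.
        exact (is_derive_plus a (fun z => u * b z) w _ _ (smooth_is_derive a Ha w)
                 (is_derive_scal b w u _ (smooth_is_derive b Hb w))).
Qed.

(** Its curves need not have unit speed for [t] nonzero: the arc-length constraint concerns only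
    [v]. *)
Lemma linear_variation (L : R) (g v : R -> E3) :
  vsmooth g -> vsmooth v -> supported_inside L v ->
  variation L g v (fun t s => plus (g s) (scal t (v s))).
Proof.
  intros (G1 & G2 & G3) (V1 & V2 & V3) (al & be & Ha & Hab & Hb & Hv).
  exists 1. split; [lra|].
  split; [|split; [|split; [|split; [|split]]]].
  - intros n t s _. now apply (affine_ex_diff_n (fun x => px (g x)) (fun x => px (v x))).
  - intros n t s _. now apply (affine_ex_diff_n (fun x => py (g x)) (fun x => py (v x))).
  - intros n t s _. now apply (affine_ex_diff_n (fun x => pz (g x)) (fun x => pz (v x))).
  - intro s. rewrite (scal_zero_l (v s) : scal 0 (v s) = zero). apply plus_zero_r.
  - intro s.
    assert (D : is_derive (fun t => plus (g s) (scal t (v s))) 0 (plus zero (scal one (v s)))).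
    { apply @is_derive_plus; [apply @is_derive_const|].
      apply @is_derive_scal_l. apply @is_derive_id. }
    rewrite plus_zero_l, scal_one in D. exact D.
  (* Midpoints again, because [v] vanishes strictly outside [[al, be]] and a variation is at rest on
     a closed region. *)
  - exists (al / 2), ((be + L) / 2). repeat split; try lra.
    intros t s _ Hs. rewrite Hv by lra.
    rewrite (scal_zero_r t : scal t (zero : E3) = zero). apply plus_zero_r.
Qed.

(** The uniqueness half: it extracts information from an assumed constraint. The assumption
    quantifies over variations, so one must be exhibited, and the lift it returns is arbitrary. *)
Lemma holonomy_derivative_unique (L : R) (g v : R -> E3) (e Wa Wb : E3) (d : R) :
  0 < L -> vsmooth g -> (forall s, speed g s = 1) -> vsmooth v -> supported_inside L v ->
  transversal g e -> (forall s, 0 <= s <= L -> dot (vderive v s) (vderive g s) = 0) ->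
  unit_normal g 0 Wa -> unit_normal g L Wb ->
  holonomy_first_variation L Wa Wb g v d -> d = - holonomy_derivative L g v.
Proof.
  intros HL Hg Hs Hv Hsupp He Hv0 HWa HWb H.
  pose proof (linear_variation L g v Hg Hv Hsupp) as HG.
  set (G := fun t s => plus (g s) (scal t (v s))) in *.
  destruct (H G HG) as (th & Hth & Dth).
  destruct (variation_holonomy L g v e G HL Hg Hs Hv Hsupp He Hv0 HG)
    as (Phi & HPhi & Hreg & Hangle).
  destruct (Hangle Wa Wb HWa HWb) as [c Hc].
  apply (lift_derive_unique th (fun t => c + Phi t)); [exact Dth| |].
  - eapply is_derive_eq.
    + apply (is_derive_plus (fun _ => c) Phi); [apply (is_derive_const c 0)|exact HPhi].
    + apply Rplus_0_l.
  - generalize (filter_and _ _ Hreg (filter_and _ _ Hth Hc)). apply filter_imp.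
    intros t [[Hr HT] [H1 H2]].
    apply (holonomy_angle_unique L Wa Wb (G t)); auto.
    unfold unit_normal in *. rewrite HT. exact HWb.
Qed.

(** * Lagrange multipliers *)

Definition pairing (L : R) (U w : R -> E3) : R := RInt (fun s => dot (U s) (w s)) 0 L.

(** Closure under this one operation stands for being a linear subspace. *)
Definition comb (w : R -> E3) (c : R) (w' : R -> E3) (s : R) : E3 := plus (w s) (scal c (w' s)).

Lemma vsmooth_comb (w w' : R -> E3) (c : R) : vsmooth w -> vsmooth w' -> vsmooth (comb w c w').
Proof.
  intros Hw Hw'. apply vsmooth_plus; [exact Hw|].
  apply vsmooth_scal; [apply smooth_const|exact Hw'].
Qed.

Lemma pairing_comb_r (L : R) (U w w' : R -> E3) (c : R) :
  vsmooth U -> vsmooth w -> vsmooth w' ->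
  pairing L U (comb w c w') = pairing L U w + c * pairing L U w'.
Proof.
  intros HU Hw Hw'. unfold pairing.
  assert (S : smooth (fun s => dot (U s) (w' s))) by now apply smooth_dot.
  rewrite RInt_Rmult_l, RInt_Rplus.
  - apply RInt_ext. intros s _. unfold comb. now rewrite dot_plus_r, dot_scal_r.
  - apply smooth_ex_RInt. now apply smooth_dot.
  - apply smooth_ex_RInt, smooth_mult; [apply smooth_const|exact S].
  - now apply smooth_ex_RInt.
Qed.

Lemma pairing_comm (L : R) (U w : R -> E3) : pairing L U w = pairing L w U.
Proof. apply RInt_ext. intros s _. apply dot_comm. Qed.

Lemma pairing_comb_l (L : R) (U U' w : R -> E3) (c : R) :
  vsmooth U -> vsmooth U' -> vsmooth w ->
  pairing L (comb U c U') w = pairing L U w + c * pairing L U' w.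
Proof.
  intros HU HU' Hw. rewrite !(pairing_comm L _ w). now apply pairing_comb_r.
Qed.

(** A linear functional that vanishes on the kernel of another is a multiple of it. If some [w0] in
    [S] has nonzero pairing with [U], subtracting a multiple of [w0] moves any [w] into the kernel;
    otherwise all of [S] is the kernel and [c = 0] works. *)
Lemma lagrange_multiplier (L : R) (S : (R -> E3) -> Prop) (U P : R -> E3) :
  vsmooth U -> vsmooth P -> (forall w, S w -> vsmooth w) ->
  (forall w c w', S w -> S w' -> S (comb w c w')) ->
  (forall w, S w -> pairing L U w = 0 -> pairing L P w = 0) ->
  exists c, forall w, S w -> pairing L (comb P c U) w = 0.
Proof.
  intros HU HP HS Hc H.
  destruct (classic (exists w0, S w0 /\ pairing L U w0 <> 0)) as [[w0 [S0 N0]]|Hno].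
  - exists (- (pairing L P w0 / pairing L U w0)). intros w Hw.
    rewrite pairing_comb_l by auto.
    pose proof (H (comb w (- (pairing L U w / pairing L U w0)) w0) (Hc _ _ _ Hw S0)) as E.
    rewrite !pairing_comb_r in E by auto.
    rewrite <- E; field; exact N0.
  - exists 0. intros w Hw. rewrite pairing_comb_l by auto. rewrite H.
    + ring.
    + exact Hw.
    + apply NNPP. intro N. apply Hno. exists w. auto.
Qed.

Definition test_field (L : R) (g w : R -> E3) : Prop :=
  vsmooth w /\ supported_inside L w /\ forall s, dot (w s) (vderive g s) = 0.

Lemma supported_inside_comb (L : R) (w w' : R -> E3) (c : R) :
  supported_inside L w -> supported_inside L w' -> supported_inside L (comb w c w').
Proof.
  intros (a & b & Ha & Hab & Hb & H) (a' & b' & Ha' & Hab' & Hb' & H').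
  exists (Rmin a a'), (Rmax b b').
  pose proof (Rmin_l a a'). pose proof (Rmin_r a a').
  pose proof (Rmax_l b b'). pose proof (Rmax_r b b').
  split; [now apply Rmin_pos|]. split; [lra|]. split; [now apply Rmax_lub_lt|].
  intros s Hs. unfold comb. rewrite H, H' by lra.
  rewrite (scal_zero_r c : scal c (zero : E3) = zero). apply plus_zero_r.
Qed.

Lemma test_field_comb (L : R) (g w w' : R -> E3) (c : R) :
  test_field L g w -> test_field L g w' -> test_field L g (comb w c w').
Proof.
  intros (A1 & A2 & A3) (B1 & B2 & B3). split; [|split].
  - now apply vsmooth_comb.
  - now apply supported_inside_comb.
  - intro s. unfold comb. rewrite dot_plus_l, dot_scal_l, A3, B3. ring.
Qed.

Lemma continuous_nonneg_RInt_zero (f : R -> R) (a b s : R) :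
  (forall x, continuous f x) -> (forall x, 0 <= f x) -> RInt f a b = 0 -> a < s < b -> f s = 0.
Proof.
  intros Hf H0 HI Hs. destruct (H0 s) as [Hp|E]; [exfalso|now rewrite <- E].
  assert (Hl : locally s (fun x => 0 < f x)).
  { apply (Hf s). apply (open_gt 0). exact Hp. }
  destruct Hl as [d Hd]. pose proof (cond_pos d) as Hd0.
  set (u := Rmax ((a + s) / 2) (s - d / 2)). set (v := Rmin ((s + b) / 2) (s + d / 2)).
  assert (Hu : a < u < s).
  { split; [apply Rlt_le_trans with ((a + s) / 2); [lra|apply Rmax_l]|].
    apply Rmax_lub_lt; lra. }
  assert (Hv : s < v < b).
  { split; [apply Rmin_glb_lt; lra|].
    apply Rle_lt_trans with ((s + b) / 2); [apply Rmin_l|lra]. }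
  pose proof (Rmax_r ((a + s) / 2) (s - d / 2)) as Hu'. fold u in Hu'.
  pose proof (Rmin_r ((s + b) / 2) (s + d / 2)) as Hv'. fold v in Hv'.
  assert (E : forall x y, ex_RInt f x y) by (intros; now apply continuous_ex_RInt).
  assert (P : 0 < RInt f u v).
  { apply RInt_gt_0; [lra| |intros; apply Hf].
    intros x Hx. apply Hd. unfold ball; simpl. unfold AbsRing_ball, abs, minus, plus, opp; simpl.
    apply Rabs_def1; lra. }
  assert (P1 : 0 <= RInt f a u) by (apply RInt_ge_0; [lra|apply E|auto]).
  assert (P2 : 0 <= RInt f v b) by (apply RInt_ge_0; [lra|apply E|auto]).
  pose proof (RInt_Chasles f a u v (E _ _) (E _ _)) as C1.
  pose proof (RInt_Chasles f a v b (E _ _) (E _ _)) as C2.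
  change (RInt f a u + RInt f u v = RInt f a v) in C1.
  change (RInt f a v + RInt f v b = RInt f a b) in C2.
  lra.
Qed.

(** Tested against a bump times its own normal part, [Q] gives the integral of a nonnegative
    continuous function. Only normal test fields are admissible, so the tangential part of [Q] stays
    free. *)
Lemma fundamental_lemma (L : R) (g Q : R -> E3) (s : R) :
  vsmooth g -> (forall s, speed g s = 1) -> vsmooth Q ->
  (forall w, test_field L g w -> pairing L Q w = 0) ->
  0 < s < L -> Q s = scal (dot (Q s) (vderive g s)) (vderive g s).
Proof.
  intros Hg Hs HQ H Hs0. set (T := vderive g) in *.
  assert (HT : vsmooth T) by now apply vsmooth_vderive.
  assert (TT : forall x, dot (T x) (T x) = 1) by (intro; apply enorm_eq_1, Hs).
  set (N := (fun x => minus (Q x) (scal (dot (Q x) (T x)) (T x))) : R -> E3).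
  assert (HN : vsmooth N).
  { apply vsmooth_minus; [exact HQ|]. apply vsmooth_scal; [now apply smooth_dot|exact HT]. }
  assert (NT : forall x, dot (N x) (T x) = 0).
  { intro x. unfold N. rewrite dot_minus_l, dot_scal_l, TT. ring. }
  assert (QN : forall x, dot (Q x) (N x) = dot (N x) (N x)).
  { intro x. unfold N at 2. rewrite dot_minus_l, dot_scal_l, (dot_comm (T x)), NT. ring. }
  destruct (smooth_bump (s / 2) ((s + L) / 2)) as (chi & Sc & C0 & C1 & C2).
  assert (I0 : RInt (fun x => chi x * dot (N x) (N x)) 0 L = 0).
  { transitivity (pairing L Q (fun x => scal (chi x) (N x))); [|apply H].
    - apply RInt_ext. intros x _. symmetry. now rewrite dot_scal_r, QN.
    - split; [|split].
      + now apply vsmooth_scal.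
      + exists (s / 2), ((s + L) / 2). repeat split; try lra. intros x Hx.
        rewrite C2 by lra. apply (scal_zero_l (N x)).
      + intro x. rewrite dot_scal_l. fold T. rewrite NT. ring. }
  apply minus_zero_eq, dot_self_eq_0. change (dot (N s) (N s) = 0).
  assert (E : chi s * dot (N s) (N s) = 0).
  { apply (continuous_nonneg_RInt_zero (fun x => chi x * dot (N x) (N x)) 0 L); auto.
    - apply smooth_continuous, smooth_mult; [exact Sc|now apply smooth_dot].
    - intro x. apply Rmult_le_pos; [apply C0|apply dot_self_ge_0]. }
  specialize (C1 s ltac:(lra)). apply Rmult_integral in E. lra.
Qed.

Definition basis_x : E3 := vec 1 0 0.
Definition basis_y : E3 := vec 0 1 0.
Definition basis_z : E3 := vec 0 0 1.

(** The four scalar constraints are traded for multipliers one at a time, each on the subspace cut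
    out by those that remain. The three constant fields encode that [w] has zero integral. *)
Lemma euler_lagrange (L : R) (g U P : R -> E3) :
  vsmooth g -> (forall s, speed g s = 1) -> vsmooth U -> vsmooth P ->
  (forall w, test_field L g w ->
     pairing L (fun _ => basis_x) w = 0 -> pairing L (fun _ => basis_y) w = 0 ->
     pairing L (fun _ => basis_z) w = 0 -> pairing L U w = 0 -> pairing L P w = 0) ->
  exists (b : E3) (c : R), forall s, 0 < s < L ->
    cross (vderive g s) (minus (P s) (plus b (scal c (U s)))) = zero.
Proof.
  intros Hg Hs HU HP H.
  pose proof (vsmooth_const basis_x) as HX. pose proof (vsmooth_const basis_y) as HY.
  pose proof (vsmooth_const basis_z) as HZ.
  destruct (lagrange_multiplier L (fun w => test_field L g w /\
      pairing L (fun _ => basis_x) w = 0 /\ pairing L (fun _ => basis_y) w = 0 /\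
      pairing L (fun _ => basis_z) w = 0) U P) as [c0 H0]; auto.
  { intros w [[A _] _]. exact A. }
  { intros w c w' (A & A1 & A2 & A3) (B & B1 & B2 & B3).
    split; [now apply test_field_comb|].
    rewrite !pairing_comb_r by (apply A || apply B || assumption).
    rewrite A1, A2, A3, B1, B2, B3. repeat split; ring. }
  { intros w (A & A1 & A2 & A3). auto. }
  pose proof (vsmooth_comb P U c0 HP HU) as S0.
  destruct (lagrange_multiplier L (fun w => test_field L g w /\
      pairing L (fun _ => basis_x) w = 0 /\ pairing L (fun _ => basis_y) w = 0)
      (fun _ => basis_z) (comb P c0 U)) as [c1 H1]; auto.
  { intros w [[A _] _]. exact A. }
  { intros w c w' (A & A1 & A2) (B & B1 & B2).
    split; [now apply test_field_comb|].
    rewrite !pairing_comb_r by (apply A || apply B || assumption).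
    rewrite A1, A2, B1, B2. repeat split; ring. }
  { intros w (A & A1 & A2) A3. auto. }
  pose proof (vsmooth_comb _ _ c1 S0 HZ) as S1.
  destruct (lagrange_multiplier L (fun w => test_field L g w /\
      pairing L (fun _ => basis_x) w = 0)
      (fun _ => basis_y) (comb (comb P c0 U) c1 (fun _ => basis_z))) as [c2 H2]; auto.
  { intros w [[A _] _]. exact A. }
  { intros w c w' (A & A1) (B & B1).
    split; [now apply test_field_comb|].
    rewrite !pairing_comb_r by (apply A || apply B || assumption).
    rewrite A1, B1. ring. }
  { intros w (A & A1) A2. auto. }
  pose proof (vsmooth_comb _ _ c2 S1 HY) as S2.
  destruct (lagrange_multiplier L (test_field L g) (fun _ => basis_x)
      (comb (comb (comb P c0 U) c1 (fun _ => basis_z)) c2 (fun _ => basis_y))) as [c3 H3]; auto.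
  { intros w [A _]. exact A. }
  { intros w c w' A B. now apply test_field_comb. }
  pose proof (vsmooth_comb _ _ c3 S2 HX) as S3.
  (* The multipliers were found in the order [U], z, y, x and added to [P]; moving them to the other
     side changes the signs. *)
  exists (vec (- c3) (- c2) (- c1)), (- c0). intros s Hs0.
  pose proof (fundamental_lemma L g _ s Hg Hs S3 H3 Hs0) as E.
  unfold comb in E.
  replace (minus (P s) (plus (vec (- c3) (- c2) (- c1)) (scal (- c0) (U s)))) with
    (plus (plus (plus (plus (P s) (scal c0 (U s))) (scal c1 basis_z)) (scal c2 basis_y))
       (scal c3 basis_x)).
  - rewrite E. generalize (dot (plus (plus (plus (plus (P s) (scal c0 (U s)))
      (scal c1 basis_z)) (scal c2 basis_y)) (scal c3 basis_x)) (vderive g s)).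
    generalize (vderive g s). clear. vring.
  - generalize (P s) (U s). clear. unfold basis_x, basis_y, basis_z. vring.
Qed.

(** * The Euler-Lagrange equation *)

Lemma constant_of_derive (f : R -> R) : (forall x, is_derive f x 0) -> forall x y, f x = f y.
Proof.
  intros H x y. destruct (Rtotal_order x y) as [Hxy|[->|Hxy]]; [|reflexivity|].
  - apply (eq_is_derive f x y); [|exact Hxy]. intros; apply H.
  - symmetry. apply (eq_is_derive f y x); [|exact Hxy]. intros; apply H.
Qed.

Lemma arclength_tangent (g : R -> E3) : (forall s, speed g s = 1) -> tangent g = vderive g.
Proof.
  intro H. apply functional_extensionality. intro s. unfold tangent, vdds. rewrite H, Rinv_1.
  apply (scal_one (vderive g s)).
Qed.

Lemma arclength_vdds_tangent (g : R -> E3) (s : R) :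
  (forall s, speed g s = 1) -> vdds g (tangent g) s = vderive (vderive g) s.
Proof.
  intro H. unfold vdds. rewrite arclength_tangent, H, Rinv_1 by exact H.
  apply (scal_one (vderive (vderive g) s)).
Qed.

Definition weighted_curvature (rho : R -> R) (g : R -> E3) (s : R) : E3 :=
  scal (rho s) (vderive (vderive g) s).

Lemma vsmooth_weighted_curvature (rho : R -> R) (g : R -> E3) :
  smooth rho -> vsmooth g -> vsmooth (weighted_curvature rho g).
Proof. intros. apply vsmooth_scal; [assumption|]. now apply vsmooth_vderive, vsmooth_vderive. Qed.

Lemma bending_by_parts (L : R) (rho : R -> R) (g w : R -> E3) :
  smooth rho -> vsmooth g -> vsmooth w -> w 0 = zero -> w L = zero ->
  RInt (fun s => rho s * dot (vderive (vderive g) s) (vderive w s)) 0 L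
  = - pairing L (vderive (weighted_curvature rho g)) w.
Proof.
  intros Hrho Hg Hw W0 WL.
  pose proof (vsmooth_weighted_curvature rho g Hrho Hg) as HA.
  set (A := weighted_curvature rho g) in *.
  assert (S1 : smooth (fun s => dot (vderive A s) (w s)))
    by (apply smooth_dot; [now apply vsmooth_vderive|exact Hw]).
  assert (S2 : smooth (fun s => dot (A s) (vderive w s)))
    by (apply smooth_dot; [exact HA|now apply vsmooth_vderive]).
  assert (E : @eq R (RInt (fun s => dot (vderive A s) (w s) + dot (A s) (vderive w s)) 0 L) 0).
  { rewrite (RInt_of_derive (fun s => dot (A s) (w s))).
    - rewrite W0, WL, !(dot_comm _ zero), !dot_zero_l. apply Rminus_diag.
    - intro s. apply is_derive_dot; now apply vsmooth_is_vderive.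
    - intro s. apply smooth_continuous. now apply smooth_plus. }
  rewrite <- RInt_Rplus in E by now apply smooth_ex_RInt.
  rewrite (RInt_ext _ (fun s => dot (A s) (vderive w s))).
  - unfold pairing. lra.
  - intros s _. unfold A, weighted_curvature. now rewrite dot_scal_l.
Qed.

Lemma RInt_eq_0 (f : R -> R) (a b : R) :
  (forall x, Rmin a b < x < Rmax a b -> f x = 0) -> @eq R (RInt f a b) 0.
Proof.
  intro H. rewrite (RInt_ext f (fun _ => 0)) by exact H.
  rewrite RInt_const. apply Rmult_0_r.
Qed.

Lemma supported_inside_antiderivative (L : R) (w : R -> E3) :
  vsmooth w -> supported_inside L w -> vRInt w 0 L = zero ->
  supported_inside L (fun s => vRInt w 0 s).
Proof.
  intros Hw (a & b & Ha & Hab & Hb & H) HL. exists a, b. repeat split; auto.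
  intros s [Hs|Hs].
  - apply E3_eq; apply RInt_eq_0; intros x Hx; rewrite H; try reflexivity;
      left; unfold Rmax in Hx; destruct (Rle_dec 0 s); lra.
  (* [s] may lie on either side of [L]; in both cases [w] vanishes between them, so the integral up
     to [s] equals the integral up to [L]. *)
  - assert (Z : forall x, Rmin L s < x < Rmax L s -> w x = zero).
    { intros x Hx. apply H. right. unfold Rmin in Hx. destruct (Rle_dec L s); lra. }
    destruct Hw as (W1 & W2 & W3).
    rewrite <- HL. apply E3_eq; symmetry.
    + pose proof (RInt_Chasles (fun x => px (w x)) 0 L s
        (smooth_ex_RInt _ _ _ W1) (smooth_ex_RInt _ _ _ W1)) as C.
      rewrite (RInt_eq_0 _ L s) in C by (intros x Hx; rewrite Z by exact Hx; reflexivity).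
      etransitivity; [|exact C]. symmetry. apply Rplus_0_r.
    + pose proof (RInt_Chasles (fun x => py (w x)) 0 L s
        (smooth_ex_RInt _ _ _ W2) (smooth_ex_RInt _ _ _ W2)) as C.
      rewrite (RInt_eq_0 _ L s) in C by (intros x Hx; rewrite Z by exact Hx; reflexivity).
      etransitivity; [|exact C]. symmetry. apply Rplus_0_r.
    + pose proof (RInt_Chasles (fun x => pz (w x)) 0 L s
        (smooth_ex_RInt _ _ _ W3) (smooth_ex_RInt _ _ _ W3)) as C.
      rewrite (RInt_eq_0 _ L s) in C by (intros x Hx; rewrite Z by exact Hx; reflexivity).
      etransitivity; [|exact C]. symmetry. apply Rplus_0_r.
Qed.

Lemma pairing_basis (L : R) (w : R -> E3) :
  pairing L (fun _ => basis_x) w = 0 -> pairing L (fun _ => basis_y) w = 0 ->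
  pairing L (fun _ => basis_z) w = 0 -> vRInt w 0 L = zero.
Proof.
  intros HX HY HZ. apply E3_eq.
  - transitivity (pairing L (fun _ => basis_x) w); [|exact HX].
    apply RInt_ext. intros s _. unfold dot, basis_x, vec, px, py, pz; simpl. ring.
  - transitivity (pairing L (fun _ => basis_y) w); [|exact HY].
    apply RInt_ext. intros s _. unfold dot, basis_y, vec, px, py, pz; simpl. ring.
  - transitivity (pairing L (fun _ => basis_z) w); [|exact HZ].
    apply RInt_ext. intros s _. unfold dot, basis_z, vec, px, py, pz; simpl. ring.
Qed.

Lemma periodic_vderive (L : R) (f : R -> E3) :
  vsmooth f -> periodic L f -> periodic L (vderive f).
Proof.
  intros (F1 & F2 & F3) H s.
  assert (D : forall p : E3 -> R, smooth (fun x => p (f x)) ->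
     Derive (fun x => p (f x)) (s + L) = Derive (fun x => p (f x)) s).
  { intros p Hp. symmetry. apply is_derive_unique.
    apply is_derive_ext with (fun x => p (f (x + L))).
    - intro x. now rewrite H.
    - eapply is_derive_eq.
      + apply (is_derive_comp (fun x => p (f x)) (fun x => x + L)).
        * apply smooth_is_derive, Hp.
        * auto_derive; [exact I|reflexivity].
      + apply (scal_one (_ : R)). }
  unfold vderive. f_equal; apply D; assumption.
Qed.

Definition motion_equation (rho : R -> R) (g : R -> E3) (a b : E3) : Prop :=
  forall s, normal_part g (fun s => euclidean_motion_field a b (g s)) s =
    scal (- rho s) (cross (tangent g s) (vdds g (tangent g) s)).

Lemma zero_at_left_end (f : R -> R) (L : R) :
  0 < L -> continuous f 0 -> (forall s, 0 < s < L -> f s = 0) -> f 0 = 0.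
Proof.
  intros HL Hf H. apply NNPP. intro N.
  assert (Hl : locally 0 (fun x => f x <> 0)).
  { apply (Hf (fun y => y <> 0)). apply (open_neq 0). exact N. }
  destruct Hl as [d Hd]. pose proof (cond_pos d) as Hd0.
  pose proof (Rmin_l (d / 2) (L / 2)). pose proof (Rmin_r (d / 2) (L / 2)).
  assert (0 < Rmin (d / 2) (L / 2)) by (apply Rmin_pos; lra).
  apply (Hd (Rmin (d / 2) (L / 2))); [|apply H; lra].
  unfold ball; simpl. unfold AbsRing_ball, abs, minus, plus, opp; simpl.
  apply Rabs_def1; lra.
Qed.

(** Test fields live inside [(0, L)] and say nothing at the base point. Continuity extends the
    vanishing of the derivative to 0, and periodicity carries constancy to the whole line. *)
Lemma periodic_constant (L : R) (f : R -> E3) :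
  0 < L -> vsmooth f -> periodic L f -> (forall s, 0 < s < L -> vderive f s = zero) ->
  forall s, f s = f 0.
Proof.
  intros HL Hf Hp H s.
  destruct (periodic_reduce L f s HL Hp) as [s' [Hs' <-]].
  pose proof (vsmooth_vderive _ Hf) as (D1 & D2 & D3).
  assert (Z : forall x, 0 <= x < L -> vderive f x = zero).
  { intros x Hx. destruct (Req_dec x 0) as [->|N]; [|apply H; lra].
    apply E3_eq.
    - apply (zero_at_left_end (fun x => px (vderive f x)) L HL); [now apply smooth_continuous|].
      intros y Hy. now rewrite H.
    - apply (zero_at_left_end (fun x => py (vderive f x)) L HL); [now apply smooth_continuous|].
      intros y Hy. now rewrite H.
    - apply (zero_at_left_end (fun x => pz (vderive f x)) L HL); [now apply smooth_continuous|].
      intros y Hy. now rewrite H. }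
  destruct (Req_dec s' 0) as [->|N]; [reflexivity|].
  assert (V : forall x, 0 <= x <= s' -> is_vderive f x zero).
  { intros x Hx. rewrite <- (Z x) by lra. now apply vsmooth_is_vderive. }
  symmetry. apply E3_eq.
  - apply (eq_is_derive (fun x => px (f x)) 0 s'); [intros; now apply V|lra].
  - apply (eq_is_derive (fun x => py (f x)) 0 s'); [intros; now apply V|lra].
  - apply (eq_is_derive (fun x => pz (f x)) 0 s'); [intros; now apply V|lra].
Qed.

Lemma closed_transversal_direction (L : R) (g : R -> E3) :
  0 < L -> vsmooth g -> periodic L g -> (forall s, speed g s = 1) ->
  exists e, transversal g e.
Proof.
  intros HL Hg Hp Hs. apply (exists_transversal_direction L (vderive g) HL).
  - now apply periodic_vderive.
  - now apply vsmooth_vderive.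
  - intro s. apply enorm_eq_1, Hs.
Qed.

Lemma motion_equation_of_elastic (L : R) (rho : R -> R) (g : R -> E3) :
  0 < L -> vsmooth g -> periodic L g -> (forall s, speed g s = 1) ->
  smooth rho -> periodic L rho -> holonomy_constrained_elastic rho L g ->
  exists a b, motion_equation rho g a b.
Proof.
  intros HL Hg Hp Hs Hrho Hrp Hel.
  destruct (closed_transversal_direction L g HL Hg Hp Hs) as [e He].
  pose proof (vsmooth_vderive _ Hg) as HT. pose proof (vsmooth_vderive _ HT) as HK.
  pose proof (vsmooth_weighted_curvature rho g Hrho Hg) as HA.
  set (U := fun s => cross (vderive g s) (vderive (vderive g) s)).
  assert (HU : vsmooth U) by now apply vsmooth_cross.
  set (P := vderive (weighted_curvature rho g)).
  assert (HP : vsmooth P) by now apply vsmooth_vderive.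
  destruct (euler_lagrange L g U P Hg Hs HU HP) as (b & c & EL).
  { intros w (Hw & Hsup & HwT) HX HY HZ HUw.
    set (v := fun s => vRInt w 0 s).
    assert (Hv : vsmooth v) by now apply vsmooth_antiderivative.
    assert (Dv : vderive v = w).
    { apply functional_extensionality. intro s.
      now apply is_vderive_unique, is_vderive_antiderivative. }
    assert (Hvs : supported_inside L v).
    { apply supported_inside_antiderivative; auto. now apply pairing_basis. }
    assert (HvT : forall s, 0 <= s <= L -> dot (vderive v s) (vderive g s) = 0).
    { intros s _. rewrite Dv. apply HwT. }
    assert (Hh : holonomy_derivative L g v = 0).
    { unfold holonomy_derivative. rewrite Dv. exact HUw. }
    assert (HF : first_variation (bending_energy rho L) L g v 0).
    { apply Hel; auto. intros Wa Wb HWa HWb.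
      rewrite <- Ropp_0, <- Hh at 1.
      now apply holonomy_first_variation_of_derivative with e. }
    (* Elasticity is applied to the straight-line variation; comparing with the computed derivative
       of its energy shows that the latter is 0. *)
    pose proof (linear_variation L g v Hg Hv Hvs) as HG.
    pose proof (is_derive_unique _ _ _ (HF _ HG)) as E1.
    pose proof (is_derive_unique _ _ _
      (bending_energy_is_derive L rho g v _ HL Hg Hs Hrho HvT HG)) as E2.
    destruct (vderive_supported L v HL Hvs) as [Z0 ZL]. rewrite Dv in Z0, ZL, E2.
    rewrite E1, bending_by_parts in E2 by assumption. unfold P. lra. }
  (* A first integral: since [T x (T x T') = - T'] and [T' x rho T' = 0], its derivative is
     [T x (P - b - c T x T')], the expression that vanishes by [EL]. *)
  set (H := fun s => plus (plus (cross (vderive g s) (weighted_curvature rho g s))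
    (cross b (g s))) (scal c (vderive g s))).
  assert (HH : vsmooth H).
  { apply vsmooth_plus; [apply vsmooth_plus|].
    - now apply vsmooth_cross.
    - apply vsmooth_cross; [apply vsmooth_const|exact Hg].
    - apply vsmooth_scal; [apply smooth_const|exact HT]. }
  assert (Hper : periodic L H).
  { pose proof (periodic_vderive L g Hg Hp) as P1.
    pose proof (periodic_vderive L _ HT P1) as P2.
    intro s. unfold H, weighted_curvature. now rewrite Hp, P1, P2, Hrp. }
  assert (TT : forall s, dot (vderive g s) (vderive g s) = 1).
  { intro s. apply enorm_eq_1, Hs. }
  pose proof (fun s => arclength_orthogonal g s Hg Hs) as TK.
  assert (HC : forall s, H s = H 0).
  { apply (periodic_constant L H HL HH Hper). intros s Hs0.
    rewrite <- (EL s Hs0). apply is_vderive_unique.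
    eapply is_vderive_eq.
    - apply is_vderive_plus; [apply is_vderive_plus; apply is_vderive_cross|apply is_vderive_scal].
      + now apply vsmooth_is_vderive.
      + now apply vsmooth_is_vderive.
      + apply is_vderive_const.
      + now apply vsmooth_is_vderive.
      + apply (is_derive_const c s).
      + now apply vsmooth_is_vderive.
    - fold P. unfold U, weighted_curvature.
      replace (cross (vderive g s) (minus (P s) (plus b (scal c (cross (vderive g s)
        (vderive (vderive g) s)))))) with
        (minus (minus (cross (vderive g s) (P s)) (cross (vderive g s) b))
           (scal c (cross (vderive g s) (cross (vderive g s) (vderive (vderive g) s))))).
      + rewrite triple_cross, TT, TK.
        generalize (vderive g s) (vderive (vderive g) s) (P s) (rho s). clear. vring.
      + generalize (vderive g s) (vderive (vderive g) s) (P s). clear. vring. }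
  (* With [H] constant, [b x gamma - H] equals [- rho T x T' - c T], and the normal part drops the
     last term. *)
  exists b, (scal (-1) (H 0)). intro s.
  unfold normal_part, euclidean_motion_field.
  rewrite arclength_vdds_tangent, arclength_tangent by exact Hs.
  rewrite <- (HC s). unfold H, weighted_curvature.
  rewrite dot_plus_l, dot_scal_l, !dot_plus_l, dot_cross_same_l, dot_scal_l, TT.
  generalize (dot (cross b (g s)) (vderive g s)).
  generalize (vderive g s) (vderive (vderive g) s) (g s) (rho s). clear. vring.
Qed.

Lemma elastic_of_motion_equation (L : R) (rho : R -> R) (g : R -> E3) (a b : E3) :
  0 < L -> vsmooth g -> periodic L g -> (forall s, speed g s = 1) ->
  smooth rho -> motion_equation rho g a b -> holonomy_constrained_elastic rho L g.
Proof.
  intros HL Hg Hp Hs Hrho Hm v Hv Hvs HvT Hhol G HG.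
  destruct (closed_transversal_direction L g HL Hg Hp Hs) as [e He].
  pose proof (arclength_regular g Hs) as Hr.
  pose proof (vsmooth_vderive _ Hg) as HT. pose proof (vsmooth_vderive _ HT) as HK.
  pose proof (vsmooth_vderive _ Hv) as Hw.
  pose proof (vsmooth_weighted_curvature rho g Hrho Hg) as HA.
  set (A := weighted_curvature rho g) in *.
  assert (TT : forall s, dot (vderive g s) (vderive g s) = 1).
  { intro s. apply enorm_eq_1, Hs. }
  pose proof (fun s => arclength_orthogonal g s Hg Hs) as TK.
  (* The constraint is stated for unit normals at the two ends, so some must be supplied; the frame
     provides them. *)
  assert (HN : forall s, unit_normal g s (frame_normal g e s)).
  { intro s. split.
    - apply enorm_eq_1. now apply frame_normal_unit.
    - rewrite dot_comm. apply frame_normal_orthogonal. }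
  assert (Hh : holonomy_derivative L g v = 0).
  { pose proof (holonomy_derivative_unique L g v e _ _ 0 HL Hg Hs Hv Hvs He HvT (HN 0) (HN L)
      (Hhol _ _ (HN 0) (HN L))). lra. }
  destruct (vderive_supported L v HL Hvs) as [Z0 ZL].
  eapply is_derive_eq; [apply (bending_energy_is_derive L rho g v G); assumption|].
  rewrite bending_by_parts by assumption. fold A.
  set (V := fun s => plus (cross a (g s)) b).
  set (f := fun s => dot (V s) (vderive g s)).
  assert (HV : forall s, is_vderive V s (cross a (vderive g s))).
  { intro s.
    pose proof (is_vderive_plus (fun s => cross a (g s)) (fun _ => b) s _ _
      (is_vderive_cross (fun _ => a) g s _ _ (is_vderive_const a s) (vsmooth_is_vderive g s Hg))
      (is_vderive_const b s)) as D.
    eapply is_vderive_eq.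
    - exact D.
    - rewrite plus_zero_r, cross_zero_l, plus_zero_l. reflexivity. }
  assert (Heq : forall s, V s = minus (scal (f s) (vderive g s)) (cross (vderive g s) (A s))).
  { intro s. specialize (Hm s). unfold normal_part, euclidean_motion_field in Hm.
    rewrite arclength_vdds_tangent, arclength_tangent in Hm by exact Hs.
    change (minus (V s) (scal (f s) (vderive g s))
      = scal (- rho s) (cross (vderive g s) (vderive (vderive g) s))) in Hm.
    transitivity (plus (minus (V s) (scal (f s) (vderive g s))) (scal (f s) (vderive g s))).
    - generalize (V s) (f s) (vderive g s). clear. vring.
    - rewrite Hm. unfold A, weighted_curvature.
      generalize (rho s) (f s) (vderive g s) (vderive (vderive g) s). clear. vring. }
  (* [f' = <a x T, T> + <V, T'>]. Both terms vanish, the second because [V] is a combination of [T]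
     and [T x T']. *)
  assert (Hf : forall s, is_derive f s 0).
  { intro s. eapply is_derive_eq.
    - apply is_derive_dot; [apply HV|now apply vsmooth_is_vderive].
    - rewrite dot_cross_same_r, Heq, dot_minus_l, dot_scal_l, TK.
      unfold A, weighted_curvature.
      replace (cross (vderive g s) (scal (rho s) (vderive (vderive g) s)))
        with (scal (rho s) (cross (vderive g s) (vderive (vderive g) s)))
        by (generalize (vderive g s) (vderive (vderive g) s) (rho s); clear; vring).
      rewrite dot_scal_l, dot_cross_same_r. ring. }
  set (c := f 0).
  assert (Hc : forall s, f s = c) by (intro; now apply constant_of_derive).
  (* Obtained by differentiating [V = c T - T x A], where [T' x A = 0] because [A] is a multiple of
     [T']. *)
  assert (HTP : forall s, cross (vderive g s) (vderive A s)
            = minus (scal c (vderive (vderive g) s)) (cross a (vderive g s))).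
  { intro s.
    assert (E : cross a (vderive g s) = minus
      (plus (scal 0 (vderive g s)) (scal c (vderive (vderive g) s)))
      (plus (cross (vderive (vderive g) s) (A s)) (cross (vderive g s) (vderive A s)))).
    { rewrite <- (is_vderive_unique V s _ (HV s)). apply is_vderive_unique.
      apply is_vderive_ext_loc with
        (fun s => minus (scal c (vderive g s)) (cross (vderive g s) (A s))).
      - apply filter_forall. intro x. rewrite Heq, Hc. reflexivity.
      - apply (is_vderive_minus (fun s => scal c (vderive g s)) (fun s => cross (vderive g s) (A s)));
          [apply (is_vderive_scal (fun _ => c))|apply is_vderive_cross];
          try (now apply vsmooth_is_vderive). apply (is_derive_const c s). }
    rewrite E. unfold A at 2. unfold weighted_curvature.
    generalize (vderive A s) (rho s) (vderive g s) (vderive (vderive g) s). clear. vring. }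
  (* As [v'] is normal, multiplying both factors by [T] preserves the scalar product. So [a] and
     [- c] are the multipliers, and each of the two terms integrates to 0 by one constraint. *)
  assert (HPw : forall s, 0 <= s <= L -> dot (vderive A s) (vderive v s)
    = dot a (vderive v s)
      + - c * dot (cross (vderive g s) (vderive (vderive g) s)) (vderive v s)).
  { intros s Hs0.
    transitivity (dot (cross (vderive g s) (vderive A s)) (cross (vderive g s) (vderive v s))).
    - rewrite dot_cross_cross, TT, (dot_comm (vderive g s) (vderive v s)), HvT by exact Hs0. ring.
    - rewrite HTP, dot_minus_l, dot_scal_l, dot_cross_cross, TT.
      rewrite (dot_comm (vderive g s) (vderive v s)), HvT by exact Hs0.
      generalize (vderive g s) (vderive (vderive g) s) (vderive v s). clear. vring. }
  assert (Ea : @eq R (RInt (fun s => dot a (vderive v s)) 0 L) 0).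
  { rewrite (RInt_of_derive (fun s => dot a (v s))).
    - destruct Hvs as (al & be & Ha & Hab & Hb & Hz). rewrite !Hz by lra. apply Rminus_diag.
    - intro s. eapply is_derive_eq.
      + apply is_derive_dot; [apply is_vderive_const|now apply vsmooth_is_vderive].
      + rewrite dot_zero_l. apply Rplus_0_l.
    - intro s. apply smooth_continuous, smooth_dot; [apply vsmooth_const|exact Hw]. }
  assert (Sa : smooth (fun s => dot a (vderive v s)))
    by (apply smooth_dot; [apply vsmooth_const|exact Hw]).
  assert (Su : smooth (fun s => dot (cross (vderive g s) (vderive (vderive g) s)) (vderive v s)))
    by (apply smooth_dot; [now apply vsmooth_cross|exact Hw]).
  unfold pairing.
  rewrite (RInt_ext _ (fun s => dot a (vderive v s)
      + - c * dot (cross (vderive g s) (vderive (vderive g) s)) (vderive v s))).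
  2: { intros s. rewrite Rmin_left, Rmax_right by lra. intro. apply HPw. lra. }
  rewrite <- RInt_Rplus.
  - rewrite <- RInt_Rmult_l by now apply smooth_ex_RInt.
    fold (holonomy_derivative L g v). rewrite Ea, Hh. ring.
  - now apply smooth_ex_RInt.
  - apply smooth_ex_RInt, smooth_mult; [apply smooth_const|exact Su].
Qed.

(** * The limit of small thickness *)

Definition vbounded (U : R -> E3) : Prop :=
  exists M, forall s, Rabs (px (U s)) <= M /\ Rabs (py (U s)) <= M /\ Rabs (pz (U s)) <= M.

Lemma vbounded_of_dot (U : R -> E3) (D : R) : (forall s, dot (U s) (U s) <= D) -> vbounded U.
Proof. intro H. exists (D + 1). intro s. now apply dot_self_bounds. Qed.

Lemma dot_of_bounds (u : E3) (M : R) :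
  Rabs (px u) <= M -> Rabs (py u) <= M -> Rabs (pz u) <= M -> dot u u <= 3 * (M * M).
Proof.
  intros H1 H2 H3. apply Rabs_le_between in H1, H2, H3. unfold dot. nra.
Qed.

Lemma periodic_vbounded (L : R) (U : R -> E3) :
  0 < L -> vsmooth U -> periodic L U -> vbounded U.
Proof.
  intros HL HU Hp.
  destruct (continuity_ab_maj (fun s => dot (U s) (U s)) 0 L) as [m [Hm _]]; [lra| |].
  - intros s _. apply continuity_pt_filterlim, smooth_continuous. now apply smooth_dot.
  - apply vbounded_of_dot with (dot (U m) (U m)). intro s.
    destruct (periodic_reduce L U s HL Hp) as [s' [Hs' <-]]. apply Hm. lra.
Qed.

Lemma dot_plus_self_le (u v : E3) : dot (plus u v) (plus u v) <= 2 * dot u u + 2 * dot v v.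
Proof.
  pose proof (dot_self_ge_0 (minus u v)) as H.
  assert (E : dot (plus u v) (plus u v) + dot (minus u v) (minus u v)
    = 2 * dot u u + 2 * dot v v) by vring.
  lra.
Qed.

Lemma dot_normal_part_le (u t : E3) :
  dot t t = 1 ->
  dot (minus u (scal (dot u t) t)) (minus u (scal (dot u t) t)) <= dot u u.
Proof.
  intro Ht. set (k := dot u t).
  rewrite dot_minus_l, !(dot_comm _ (minus _ _)), !dot_minus_l, !dot_scal_l, !dot_scal_r.
  rewrite Ht, (dot_comm t u). fold k. nra.
Qed.

Lemma biot_savart_vbounded (L c1 a0 : R) (g : R -> E3) :
  0 < L -> vsmooth g -> periodic L g -> (forall s, speed g s = 1) -> 0 < c1 -> 0 < a0 ->
  vbounded (biot_savart L c1 a0 g).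
Proof.
  intros HL Hg Hp Hs Hc Ha.
  destruct (periodic_vbounded L g HL Hg Hp) as [M HM].
  pose proof (vsmooth_vderive _ Hg) as HT.
  destruct (vbounded_of_dot (vderive g) 1) as [K HK].
  { intro s. right. apply enorm_eq_1, Hs. }
  assert (HM0 : 0 <= M) by (eapply Rle_trans; [apply Rabs_pos|apply (HM 0)]).
  assert (HK0 : 0 <= K) by (eapply Rle_trans; [apply Rabs_pos|apply (HK 0)]).
  assert (Hca : 0 < c1 * a0 ^ 2) by (apply Rmult_lt_0_compat; [exact Hc|now apply pow_lt]).
  (* The regularization [c1 a0^2] keeps the denominator away from 0, even at coinciding points. *)
  set (m := Rpower (c1 * a0 ^ 2) (3 / 2)).
  assert (Hm : 0 < m) by apply exp_pos.
  set (h := fun s s' => Rsqr (enorm (minus (g s) (g s'))) + c1 * a0 ^ 2).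
  assert (Hh : forall s s', c1 * a0 ^ 2 <= h s s').
  { intros s s'. unfold h. pose proof (Rle_0_sqr (enorm (minus (g s) (g s')))). lra. }
  assert (Hhs : forall s, smooth (h s)).
  { intro s. unfold h. apply smooth_plus; [|apply smooth_const].
    replace (fun x => Rsqr (enorm (minus (g s) (g x)))) with
      (fun x => dot (minus (g s) (g x)) (minus (g s) (g x)))
      by (apply functional_extensionality; intro; symmetry; apply enorm_sqr).
    apply smooth_dot; apply vsmooth_minus; auto using vsmooth_const. }
  assert (Hi : forall s s', 0 < / Rpower (h s s') (3 / 2) <= / m).
  { intros s s'. split; [apply Rinv_0_lt_compat, exp_pos|].
    apply Rinv_le_contravar; [exact Hm|]. apply Rle_Rpower_l; [lra|]. split; [exact Hca|apply Hh]. }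
  assert (Hic : forall s s', continuous (fun x => / Rpower (h s x) (3 / 2)) s').
  { intros s s'. apply @ex_derive_continuous. unfold Rpower.
    auto_derive. specialize (Hh s s'). repeat split.
    - apply (smooth_ex_derive (h s)), Hhs.
    - lra.
    - apply Rgt_not_eq, exp_pos. }
  (* [p] and [q] are two coordinate projections; the three cyclic choices give the components of the
     cross product. *)
  assert (Hb : forall (s : R) (p q : E3 -> R),
     (forall x, Rabs (p (vderive g x)) <= K /\ Rabs (q (vderive g x)) <= K) ->
     (forall x, Rabs (p (minus (g s) (g x))) <= 2 * M /\ Rabs (q (minus (g s) (g x))) <= 2 * M) ->
     smooth (fun x => p (vderive g x)) -> smooth (fun x => q (vderive g x)) ->
     smooth (fun x => p (minus (g s) (g x))) -> smooth (fun x => q (minus (g s) (g x))) ->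
     Rabs (RInt (fun x => / Rpower (h s x) (3 / 2) * (p (vderive g x) * q (minus (g s) (g x))
                   - q (vderive g x) * p (minus (g s) (g x)))) 0 L)
       <= (L - 0) * (/ m * (K * (2 * M) + K * (2 * M)))).
  { intros s p q B1 B2 S1 S2 S3 S4. apply abs_RInt_le_const; [lra| |].
    - apply continuous_ex_RInt. intro x.
      apply (continuous_mult (fun x => / Rpower (h s x) (3 / 2))); [apply Hic|].
      apply smooth_continuous. apply smooth_minus; now apply smooth_mult.
    - intros x _. rewrite Rabs_mult. specialize (Hi s x).
      rewrite (Rabs_pos_eq (/ _)) by lra.
      apply Rmult_le_compat; [lra|apply Rabs_pos|lra|].
      unfold Rminus. eapply Rle_trans; [apply Rabs_triang|].
      rewrite Rabs_Ropp, !Rabs_mult.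
      destruct (B1 x), (B2 x).
      apply Rplus_le_compat; apply Rmult_le_compat; auto using Rabs_pos. }
  assert (Hd : forall a b, Rabs a <= M -> Rabs b <= M -> Rabs (a - b) <= 2 * M).
  { intros a b H1 H2. apply Rabs_le_between in H1, H2. apply Rabs_le. lra. }
  assert (DX : forall s x, px (minus (g s) (g x)) = px (g s) - px (g x)) by reflexivity.
  assert (DY : forall s x, py (minus (g s) (g x)) = py (g s) - py (g x)) by reflexivity.
  assert (DZ : forall s x, pz (minus (g s) (g x)) = pz (g s) - pz (g x)) by reflexivity.
  assert (BD : forall s x, Rabs (px (minus (g s) (g x))) <= 2 * M /\
    Rabs (py (minus (g s) (g x))) <= 2 * M /\ Rabs (pz (minus (g s) (g x))) <= 2 * M).
  { intros s x. rewrite DX, DY, DZ. destruct (HM s) as (? & ? & ?), (HM x) as (? & ? & ?).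
    repeat split; now apply Hd. }
  assert (SD : forall s, vsmooth (fun x => minus (g s) (g x))).
  { intro s. apply vsmooth_minus; auto using vsmooth_const. }
  destruct HT as (T1 & T2 & T3).
  eexists. intro s. destruct (SD s) as (D1 & D2 & D3).
  unfold biot_savart. rewrite arclength_tangent by exact Hs.
  split; [|split].
  - apply (Hb s py pz); auto; intro x; split; apply HK || apply BD.
  - apply (Hb s pz px); auto; intro x; split; apply HK || apply BD.
  - apply (Hb s px py); auto; intro x; split; apply HK || apply BD.
Qed.

Lemma uniform_limit_pointwise (X : R -> R -> E3) (Y : R -> E3) (s : R) :
  uniform_limit_at_0 X Y -> filterlim (fun a1 => X a1 s) (at_right 0) (locally (Y s)).
Proof.
  intros H P [eps HP]. apply (H (fun f => P (f s))).
  exists eps. intros f Hf. apply HP, Hf.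
Qed.

Lemma uniform_limit_unique (X : R -> R -> E3) (Y Y' : R -> E3) :
  uniform_limit_at_0 X Y -> uniform_limit_at_0 X Y' -> forall s, Y s = Y' s.
Proof.
  intros H H' s.
  apply (filterlim_locally_unique (fun a1 => X a1 s) (F := at_right 0));
    now apply uniform_limit_pointwise.
Qed.

Lemma uniform_limit_of_remainder (X : R -> R -> E3) (Y M : R -> E3) :
  vbounded M ->
  (forall a1 s, 0 < a1 < 1 -> X a1 s = plus (Y s) (scal (/ ln a1) (M s))) ->
  uniform_limit_at_0 X Y.
Proof.
  intros [K HK] HX P [eps HP].
  assert (HK0 : 0 <= K) by (eapply Rle_trans; [apply Rabs_pos|apply (HK 0)]).
  pose proof (cond_pos eps) as Heps.
  (* For [a1 < d] the absolute value of [ln a1] exceeds [(K + 1) / eps], so a remainder bounded by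
     [K] becomes smaller than [eps]. The 1 added to [K] keeps the quotient positive, which also
     forces [a1 < 1]. *)
  set (d := exp (- ((K + 1) / eps))).
  assert (Hd : 0 < d) by apply exp_pos.
  exists (mkposreal d Hd). intros a1 Ha Ha0. unfold ball in Ha; simpl in Ha.
  unfold AbsRing_ball, abs, minus, plus, opp in Ha; simpl in Ha.
  apply Rabs_def2 in Ha.
  assert (Hq : 0 < (K + 1) / eps) by (apply Rdiv_lt_0_compat; lra).
  assert (Hln : ln a1 < - ((K + 1) / eps)).
  { rewrite <- (ln_exp (- ((K + 1) / eps))). apply ln_increasing; [exact Ha0|]. fold d. lra. }
  assert (Hinv : Rabs (/ ln a1) * (K + 1) < eps).
  { rewrite Rabs_inv, Rabs_left by lra.
    apply Rmult_lt_reg_l with (- ln a1); [lra|].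
    rewrite <- Rmult_assoc, Rinv_r, Rmult_1_l by lra.
    replace (K + 1) with ((K + 1) / eps * eps) by (field; lra).
    apply Rmult_lt_compat_r; lra. }
  assert (Ha1 : a1 < 1).
  { rewrite <- exp_0. apply Rlt_trans with d; [lra|]. apply exp_increasing. lra. }
  assert (B : forall y x, Rabs x <= K -> Rabs (y + / ln a1 * x - y) < eps).
  { intros y x Hx. replace (y + / ln a1 * x - y) with (/ ln a1 * x) by ring.
    rewrite Rabs_mult. eapply Rle_lt_trans; [|exact Hinv].
    apply Rmult_le_compat_l; [apply Rabs_pos|lra]. }
  apply HP. intro s. rewrite HX by lra.
  destruct (HK s) as (B1 & B2 & B3).
  split; [split|]; apply B; assumption.
Qed.

(** The remainder is exact: [ln (a / a0) = rho ln a1 - ln a0], so besides the normal part of the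
    Biot-Savart field only [ln a0 T x T'] is left over [ln a1]. *)
Lemma filament_velocity_limit (L : R) (g : R -> E3) (rho : R -> R) (c1 c2 a0 : R) :
  0 < L -> vsmooth g -> periodic L g -> (forall s, speed g s = 1) -> 0 < c1 -> 0 < a0 ->
  uniform_limit_at_0
    (fun a1 => normal_part g (fun s =>
       scal (/ ln a1) (filament_velocity L c1 c2 a0 g (fun x => Rpower a1 (rho x)) s)))
    (fun s => scal (- rho s) (cross (tangent g s) (vdds g (tangent g) s))).
Proof.
  intros HL Hg Hp Hs Hc Ha.
  pose proof (vsmooth_vderive _ Hg) as HT.
  pose proof (periodic_vderive L g Hg Hp) as P1.
  pose proof (periodic_vderive L _ HT P1) as P2.
  assert (TT : forall s, dot (vderive g s) (vderive g s) = 1).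
  { intro s. apply enorm_eq_1, Hs. }
  set (C := fun s => cross (vderive g s) (vderive (vderive g) s)).
  assert (HC : vsmooth C) by (apply vsmooth_cross; [exact HT|now apply vsmooth_vderive]).
  set (B := biot_savart L c1 a0 g).
  apply uniform_limit_of_remainder with (fun s =>
    plus (minus (B s) (scal (dot (B s) (vderive g s)) (vderive g s))) (scal (ln a0) (C s))).
  - destruct (biot_savart_vbounded L c1 a0 g HL Hg Hp Hs Hc Ha) as [M HM].
    destruct (periodic_vbounded L C HL HC) as [K HK].
    { intro s. unfold C. now rewrite P1, P2. }
    apply vbounded_of_dot with
      (2 * (3 * (M * M)) + 2 * (ln a0 * ln a0 * (3 * (K * K)))).
    intro s. eapply Rle_trans; [apply dot_plus_self_le|].
    apply Rplus_le_compat; (apply Rmult_le_compat_l; [lra|]).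
    + eapply Rle_trans; [apply dot_normal_part_le, TT|].
      destruct (HM s) as (? & ? & ?). now apply dot_of_bounds.
    + rewrite dot_scal_l, dot_scal_r, <- Rmult_assoc.
      apply Rmult_le_compat_l; [apply Rle_0_sqr|].
      destruct (HK s) as (? & ? & ?). now apply dot_of_bounds.
  - intros a1 s Ha1.
    assert (Hl : ln a1 < 0) by (rewrite <- ln_1; apply ln_increasing; lra).
    unfold normal_part, filament_velocity.
    rewrite arclength_vdds_tangent, arclength_tangent by exact Hs.
    fold B. change (cross (vderive g s) (vderive (vderive g) s)) with (C s).
    assert (CT : dot (C s) (vderive g s) = 0) by apply dot_cross_same_l.
    rewrite ln_div by (exact Ha || apply exp_pos).
    unfold Rpower at 1. rewrite ln_exp.
    (* The value of this tangential coefficient does not matter, since the projection removes it. *)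
    set (q := c2 / Rpower a1 (rho s) * dds g (fun x => Rpower a1 (rho x)) s).
    rewrite dot_scal_l, !dot_minus_l, !dot_scal_l, CT, TT.
    generalize (dot (B s) (vderive g s)).
    replace (rho s * ln a1 - ln a0) with (ln a1 * (rho s - / ln a1 * ln a0)) by (field; lra).
    replace (scal (/ ln a1) (minus (minus (B s) (scal (ln a1 * (rho s - / ln a1 * ln a0)) (C s)))
        (scal q (vderive g s)))) with
      (minus (minus (scal (/ ln a1) (B s)) (scal (rho s - / ln a1 * ln a0) (C s)))
        (scal (/ ln a1 * q) (vderive g s))).
    + generalize (/ ln a1) (ln a0) (rho s) (ln a1) q (B s) (C s) (vderive g s). clear. vring.
    + replace (scal (rho s - / ln a1 * ln a0) (C s)) with
        (scal (/ ln a1) (scal (ln a1 * (rho s - / ln a1 * ln a0)) (C s))).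
      * generalize (/ ln a1) (ln a0) (rho s) (ln a1) q (B s) (C s) (vderive g s). clear. vring.
      * rewrite scal_assoc. f_equal. unfold mult; simpl. field. lra.
Qed.

Theorem corollary5p5 (L : R) (gamma : R -> E3) (rho : R -> R) (c1 c2 a0 : R)
  (L_pos : 0 < L)
  (gamma_smooth : vsmooth gamma)
  (gamma_closed : periodic L gamma)
  (gamma_arclength : forall s, speed gamma s = 1)
  (rho_smooth : smooth rho)
  (rho_closed : periodic L rho)
  (rho_pos : forall s, 0 < rho s)
  (c1_pos : 0 < c1)
  (a0_range : 0 < a0 < 1) :
  holonomy_constrained_elastic rho L gamma <->
  exists a b : E3,
    uniform_limit_at_0
      (fun a1 => normal_part gamma (fun s =>
         scal (/ ln a1)
           (filament_velocity L c1 c2 a0 gamma (fun x => Rpower a1 (rho x)) s)))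
      (normal_part gamma (fun s => euclidean_motion_field a b (gamma s))).
Proof.
  (* The limit always exists; only whether it is the normal part of a Euclidean motion is in
     question, and uniqueness of limits makes this the motion equation. *)
  pose proof (filament_velocity_limit L gamma rho c1 c2 a0 L_pos gamma_smooth gamma_closed
    gamma_arclength c1_pos (proj1 a0_range)) as Hlim.
  split.
  - intro Hel.
    destruct (motion_equation_of_elastic L rho gamma) as (a & b & Hab); auto.
    exists a, b.
    replace (normal_part gamma (fun s => euclidean_motion_field a b (gamma s))) with
      (fun s => scal (- rho s) (cross (tangent gamma s) (vdds gamma (tangent gamma) s))).
    + exact Hlim.
    + apply functional_extensionality. intro s. symmetry. apply Hab.
  - intros (a & b & H).
    apply (elastic_of_motion_equation L rho gamma a b); auto.
    intro s. exact (uniform_limit_unique _ _ _ H Hlim s).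
Qed.
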